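(* Let a domain $v$ be a triple $(\mu^{(v)}, f^{(v)}, g^{(v)})$ with $\mu^{(v)}$ a distribution on $\mathbb{R}^d$, $f^{(v)}:\mathbb{R}^d\to\mathbb{R}^{d'}$ and $g^{(v)}:\mathbb{R}^{d'}\to\mathcal{Y}$, and $h^{(v)}=g^{(v)}\circ f^{(v)}$. Let $u$ be the unseen domain and $s=1,\dots,S$ the seen domains. For $h=g\circ f$ define $R^{(v)}(h):=\mathbb{E}_{\bm{x}\sim\mu^{(v)}}[\ell(h(\bm{x}),h^{(v)}(\bm{x}))]$. Assume (i) $\ell$ is non-negative, symmetric, bounded by a finite positive number $L$, and satisfies the triangle inequality; and (ii) $f$ is invertible when restricted to the data manifold (the support of the input distributions). Call a distribution on $\mathbb{R}^{d'}$ $(c_1,c_2)$-regular ($c_1,c_2\ge0$) if it is absolutely continuous w.r.t. Lebesgue measure with differentiable density $p$ satisfying $\|\nabla\log_2 p(\bm{x})\|_2\le c_1\|\bm{x}\|_2+c_2$ for all $\bm{x}$. If the pushforwards $f_{\#}\mu^{(s)}$, $s=1,\dots,S$, and $f_{\#}\mu^{(u)}$ are all $(c_1,c_2)$-regular, then for all convex weights $\lambda^{(1)},\dots,\lambda^{(S)}$ and any such hypothesis $h=g\circ f$, \[ R^{(u)}(h)\le\sum_{s=1}^S\lambda^{(s)}R^{(s)}(h)+LC\Big[\sum_{s=1}^S\lambda^{(s)}\mathsf{W}_2^2(f_{\#}\mu^{(u)},f_{\#}\mu^{(s)})\Big]^{1/4}+\sum_{s=1}^S\lambda^{(s)}\sigma^{(u,s)},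 \] where $\mathsf{W}_2$ is the Wasserstein-2 distance, $\sigma^{(u,s)}:=\min\{\mathbb{E}_{\bm{x}\sim\mu^{(u)}}[\ell(h^{(u)}(\bm{x}),h^{(s)}(\bm{x}))],\ \mathbb{E}_{\bm{x}\sim\mu^{(s)}}[\ell(h^{(u)}(\bm{x}),h^{(s)}(\bm{x}))]\}$, and \[ C=\max_s\sqrt{c_1\Big(\sqrt{\mathbb{E}_{\bm{x}\sim\mu^{(u)}}[\|f(\bm{x})\|^2]}+\sqrt{\mathbb{E}_{\bm{x}\sim\mu^{(s)}}[\|f(\bm{x})\|^2]}\Big)+2c_2}. \]
   Context: Main result of the paper for domain generalization. The term $\sum_s\lambda^{(s)}\sigma^{(u,s)}$ is independent of both the representation map $f$ and the labeling function $g$. Regularity of the pushforwards can be ensured in practice by adding small independent Gaussian noise in representation space. *)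

(* Defs.v *)
From HB Require Import structures.
From mathcomp Require Import all_boot all_order all_algebra.
From mathcomp Require Import all_classical all_reals all_analysis.
Set Implicit Arguments. Unset Strict Implicit. Unset Printing Implicit Defensive.
Import Order.TTheory GRing.Theory Num.Theory.
Import numFieldNormedType.Exports.
Local Open Scope classical_set_scope.
Local Open Scope ring_scope.

Definition Rn (R : realType) (n : nat) := g_sigma_algebraType (@open 'rV[R]_n).

Definition enorm (R : realType) (n : nat) (x : 'rV[R]_n) : R :=
  Num.sqrt (\sum_(i < n) x ord0 i ^+ 2).

Definition grad (R : realType) (n : nat) (F : 'rV[R]_n -> R) (x : 'rV[R]_n)
  : 'rV[R]_n := \row_(i < n) 'D_(delta_mx ord0 i) F x.

Definition log2 (R : realType) (y : R) : R := ln y / ln 2.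

Definition is_lebesgue (R : realType) (n : nat)
  (lam : {measure set (Rn R n) -> \bar R}) : Prop :=
  forall a b : 'rV[R]_n, (forall i, a ord0 i <= b ord0 i) ->
    lam [set x : Rn R n | forall i, a ord0 i < x ord0 i <= b ord0 i]
    = (\prod_(i < n) (b ord0 i - a ord0 i))%:E.

Definition regular (R : realType) (n : nat) (c1 c2 : R)
  (P : set (Rn R n) -> \bar R) : Prop :=
  exists (lam : {measure set (Rn R n) -> \bar R}) (p : 'rV[R]_n -> R),
    [/\ is_lebesgue lam,
        (forall x, 0 < p x),
        (forall x, differentiable p x),
        (forall A : set (Rn R n), measurable A ->
           P A = (\int[lam]_(x in A) (p x)%:E)%E) &
        (forall x : 'rV[R]_n,
           enorm (grad (fun y => log2 (p y)) x) <= c1 * enorm x + c2)].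

Definition couplings (R : realType) (n : nat) (P Q : set (Rn R n) -> \bar R)
  : set (probability (Rn R n * Rn R n)%type R) :=
  [set pi | forall A : set (Rn R n), measurable A ->
      pushforward pi fst A = P A /\ pushforward pi snd A = Q A].

Definition W2sq (R : realType) (n : nat) (P Q : set (Rn R n) -> \bar R) : R :=
  fine (ereal_inf [set (\int[pi]_z ((enorm ((z.1 : 'rV[R]_n) - z.2)) ^+ 2)%:E)%E
                   | pi in couplings P Q]).

Definition msupport (R : realType) (n : nat) (mu : set (Rn R n) -> \bar R)
  : set 'rV[R]_n :=
  [set x | forall U : set 'rV[R]_n, open U -> U x -> (0 < mu U)%E].

Definition expect d (T : measurableType d) (R : realType)
  (mu : probability T R) (F : T -> R) : R :=
  fine (\int[mu]_x (F x)%:E)%E.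

(* Main.v *)
(** Let P and Q be the pushforwards of the unseen and of one seen input distribution,
    with densities p and q, and let phi = ln p - ln q.
    - The regularity condition and the mean value theorem make phi locally Lipschitz with
      constant 2 (c1 (|x| + |y|) + c2), so for every coupling (X, Y) of P and Q the
      Cauchy-Schwarz inequality bounds J = E[phi X - phi Y] by
      2 (c1 (sqrt E|X|^2 + sqrt E|Y|^2) + c2) sqrt E|X - Y|^2.
    - J is also the symmetrised Kullback-Leibler divergence, the integral of
      (p - q) (ln p - ln q), and (a - b) (ln a - ln b) >= (a - b)^2 / (a + b)
      gives TV(P, Q)^2 <= J / 2, a crude form of Pinsker's inequality which is enough
      because the target constant has slack (ln 2 <= 1).
    - As f is injective on the supports, Borel sets of inputs are, up to small measure,
      preimages under f of compact sets, so expectations of functions with values in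
      [0, L] under the two input distributions differ by at most L TV(P, Q).
    - The triangle inequality for the loss introduces the term sigma, and two uses of
      the convexity of the square move the average over s inside the fourth root. *)

Require Import Defs.
From HB Require Import structures.
From mathcomp Require Import all_boot all_order all_algebra.
From mathcomp Require Import all_classical all_reals all_analysis.
From mathcomp Require Import measurable_realfun ring lra.
Import Order.TTheory GRing.Theory Num.Theory.
Import numFieldNormedType.Exports.
Local Open Scope classical_set_scope.
Local Open Scope ring_scope.
Set Implicit Arguments.
Unset Strict Implicit.

(** * Real inequalities and the Euclidean norm *)

(** The weight [t = a / (2 u)] gives [a <= a / 2 + 2 u v / a], which is the claim. Both
    Cauchy-Schwarz inequalities and the Pinsker-type bound are concluded by this passage from all
    weights to a product. *)
Lemma sqr_le_of_amgm (R : realType) (a u v : R) : 0 <= a -> 0 <= u -> 0 <= v ->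
  (forall t, 0 < t -> a <= t * u + t^-1 * v) -> a ^+ 2 <= 4 * u * v.
Proof.
move=> a0 u0 v0 h.
have [->|an0] := eqVneq a 0; first by rewrite expr0n/= !mulr_ge0.
have {an0}a_gt0 : 0 < a by rewrite lt_neqAle eq_sym an0.
have [u_eq0|un0] := eqVneq u 0.
  (* For [u = 0] the hypothesis reads [a <= v / t], and this [t] makes [v / t] at most [a / 2],
     which is absurd. The [+ 1] keeps [t] positive when [v = 0]. *)
  have := h (2 * v / a + 1) (ltr_wpDl (divr_ge0 (mulr_ge0 (ler0n _ 2) v0) a0) ltr01).
  rewrite u_eq0 mulr0 add0r mulrC => h1.
  have : a <= a / 2; last lra.
  apply: (le_trans h1); rewrite ler_pdivrMr; last first.
    by rewrite ltr_wpDl// divr_ge0// mulr_ge0.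
  have -> : a / 2 * (2 * v / a + 1) = v + a / 2 by field; rewrite lt0r_neq0.
  by rewrite lerDl; lra.
have u_gt0 : 0 < u by rewrite lt_neqAle eq_sym un0.
have := h (a / (2 * u)) (divr_gt0 a_gt0 (mulr_gt0 (ltr0Sn _ 1) u_gt0)).
have -> : a / (2 * u) * u + (a / (2 * u))^-1 * v = a / 2 + 2 * u * v / a.
  by field; rewrite !lt0r_neq0.
rewrite -lerBlDl ler_pdivlMr// expr2 => h1; lra.
Qed.

(** For [b <= a], [ln (b / a) <= b / a - 1] gives [ln a - ln b >= (a - b) / a]. Enlarging the
    denominator to [a + b] makes the bound symmetric, which settles the other order. *)
Lemma ln_diff_mul_ge (R : realType) (a b : R) : 0 < a -> 0 < b ->
  (a - b) ^+ 2 / (a + b) <= (a - b) * (ln a - ln b).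
Proof.
have key (x y : R) : 0 < x -> 0 < y -> y <= x ->
    (x - y) ^+ 2 / (x + y) <= (x - y) * (ln x - ln y).
  move=> x0 y0 yx; rewrite expr2 -mulrA; apply: ler_wpM2l; first lra.
  have yx0 : 0 < y / x by rewrite divr_gt0.
  have : ln (1 + (y / x - 1)) <= y / x - 1 by apply: le_ln1Dx; lra.
  rewrite addrC subrK ln_div ?posrE// => h.
  apply: (@le_trans _ _ (1 - y / x)); last lra.
  have -> : 1 - y / x = (x - y) / x by field; rewrite gt_eqF.
  by apply: ler_wpM2l; [lra|rewrite lef_pV2 ?posrE; lra].
move=> a0 b0; have [ab|/ltW ba] := leP b a; first exact: key.
have := key _ _ b0 a0 ba.
by rewrite -(opprB b a) sqrrN mulNr -mulrN opprB (addrC a b).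
Qed.

(** Weighted AM-GM for [sqrt (a + b)] and [|a - b| / sqrt (a + b)], followed by [ln_diff_mul_ge].
    Taken at two probability densities and integrated, the first term becomes [t] and the second a
    multiple of the symmetrised divergence. *)
Lemma normB_amgm (R : realType) (t a b : R) : 0 < t -> 0 < a -> 0 < b ->
  `|a - b| <= t / 2 * (a + b) + t^-1 / 2 * ((a - b) * (ln a - ln b)).
Proof.
move=> t0 a0 b0.
have ab0 : 0 < a + b by rewrite addr_gt0.
apply: (@le_trans _ _ (t / 2 * (a + b) + t^-1 / 2 * ((a - b) ^+ 2 / (a + b)))); last first.
  by rewrite lerD2l ler_wpM2l ?ln_diff_mul_ge// mulr_ge0// invr_ge0 ltW.
rewrite -(real_normK (num_real (a - b))); set x := `|_|.
rewrite -subr_ge0.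
have -> : t / 2 * (a + b) + t^-1 / 2 * (x ^+ 2 / (a + b)) - x =
    (t * (a + b) - x) ^+ 2 / (2 * t * (a + b)).
  by field; rewrite !lt0r_neq0.
by rewrite divr_ge0 ?sqr_ge0// !mulr_ge0// ltW.
Qed.

(** Cauchy-Schwarz, from [2 a b <= t a^2 + b^2 / t] summed over the coordinates for every
    [t > 0]. *)
Lemma sum_mul_le_enorm (R : realType) (n : nat) (x y : 'rV[R]_n) :
  \sum_(i < n) x ord0 i * y ord0 i <= enorm x * enorm y.
Proof.
set s := \sum_(i < n) _.
have [s0|s0] := leP s 0; first by rewrite (le_trans s0)// mulr_ge0// sqrtr_ge0.
have sq (z : 'rV[R]_n) : 0 <= \sum_(i < n) z ord0 i ^+ 2.
  by apply: sumr_ge0 => i _; exact: sqr_ge0.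
rewrite -(ger0_norm (ltW s0)) -sqrtr_sqr -sqrtrM// ler_wsqrtr//.
have : (2 * s) ^+ 2 <= 4 * (\sum_(i < n) x ord0 i ^+ 2) * (\sum_(i < n) y ord0 i ^+ 2).
  apply: sqr_le_of_amgm => //; first by rewrite mulr_ge0// ltW.
  move=> t t0; rewrite !mulr_sumr -big_split/=; apply: ler_sum => i _.
  rewrite -subr_ge0.
  set a := x _ _; set b := y _ _.
  have -> : t * a ^+ 2 + t^-1 * b ^+ 2 - 2 * (a * b) = (t * a - b) ^+ 2 / t.
    by field; rewrite lt0r_neq0.
  by rewrite divr_ge0 ?sqr_ge0// ltW.
by rewrite exprMn -natrX -mulrA ler_pM2l.
Qed.

Lemma enorm_ge0 (R : realType) (n : nat) (x : 'rV[R]_n) : 0 <= enorm x.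
Proof. exact: sqrtr_ge0. Qed.

Lemma sqr_enorm (R : realType) (n : nat) (x : 'rV[R]_n) :
  enorm x ^+ 2 = \sum_(i < n) x ord0 i ^+ 2.
Proof. by rewrite sqr_sqrtr// sumr_ge0// => i _; exact: sqr_ge0. Qed.

Lemma enormD (R : realType) (n : nat) (x y : 'rV[R]_n) :
  enorm (x + y) <= enorm x + enorm y.
Proof.
rewrite -(@ler_pXn2r _ 2)// ?nnegrE ?addr_ge0 ?enorm_ge0//.
rewrite sqr_enorm sqrrD !sqr_enorm.
under eq_bigr do rewrite mxE sqrrD.
rewrite !big_split/= lerD2r lerD2l -mulr2n ler_pMn2r//.
exact: sum_mul_le_enorm.
Qed.

Lemma enormZ (R : realType) (n : nat) (k : R) (x : 'rV[R]_n) :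
  enorm (k *: x) = `|k| * enorm x.
Proof.
rewrite /enorm; under eq_bigr do rewrite mxE exprMn.
by rewrite -mulr_sumr sqrtrM ?sqr_ge0// sqrtr_sqr.
Qed.

Lemma sqr_enormB (R : realType) (n : nat) (x y : 'rV[R]_n) :
  enorm (x - y) ^+ 2 <= 2 * enorm x ^+ 2 + 2 * enorm y ^+ 2.
Proof.
rewrite !sqr_enorm !mulr_sumr -big_split/=; apply: ler_sum => i _.
rewrite !mxE -subr_ge0; set a := x _ _; set b := y _ _.
have -> : 2 * a ^+ 2 + 2 * b ^+ 2 - (a - b) ^+ 2 = (a + b) ^+ 2 by ring.
exact: sqr_ge0.
Qed.

(** * Borel sets and Lebesgue measure on R^n *)

(** These are the sets on which [is_lebesgue] prescribes the measure; being half-open, they are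
    stable under intersection. *)
Definition box (R : realType) (n : nat) (a b : 'rV[R]_n) : set (Rn R n) :=
  [set x | forall i, a ord0 i < x ord0 i <= b ord0 i].

Lemma measurable_open (R : realType) (n : nat) (U : set 'rV[R]_n) :
  open U -> measurable (U : set (Rn R n)).
Proof. exact: sub_sigma_algebra. Qed.

Lemma measurable_closed (R : realType) (n : nat) (F : set 'rV[R]_n) :
  closed F -> measurable (F : set (Rn R n)).
Proof.
move=> cF; rewrite -(setCK F); apply: measurableC.
by apply: measurable_open; exact: closed_openC.
Qed.

Lemma continuous_measurable (R : realType) (n : nat) (h : 'rV[R]_n -> R) :
  continuous h -> measurable_fun [set: Rn R n] (h : Rn R n -> R).
Proof.
move=> /continuousP ch; apply: (measurability _ (RGenOpens.measurableE R)).
move=> _ [_ [x [y ->] <-]]; rewrite setTI; apply: measurable_open.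
by apply: ch; exact: interval_open.
Qed.

Lemma measurable_coord (R : realType) (n : nat) (i : 'I_n) :
  measurable_fun [set: Rn R n] (fun x : Rn R n => (x : 'rV[R]_n) ord0 i).
Proof. by apply: continuous_measurable; exact: coord_continuous. Qed.

Lemma measurable_box (R : realType) (n : nat) (a b : 'rV[R]_n) :
  measurable (box a b).
Proof.
have -> : box a b = \bigcap_(i in [set: 'I_n])
    ((fun x : Rn R n => (x : 'rV[R]_n) ord0 i) @^-1` `]a ord0 i, b ord0 i]%classic).
  apply/seteqP; split => x /= h i; last by have := h i I; rewrite /= in_itv.
  by move=> _ /=; rewrite in_itv/=; exact: h.
apply: fin_bigcap_measurable => [|i _]; first exact: finite_finset.
by rewrite -[X in measurable X]setTI; exact: measurable_coord.
Qed.

Lemma setI_box (R : realType) (n : nat) (a b c d : 'rV[R]_n) :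
  box a b `&` box c d =
  box (\row_i Num.max (a ord0 i) (c ord0 i)) (\row_i Num.min (b ord0 i) (d ord0 i)).
Proof.
apply/seteqP; split => x /=.
  by move=> [h1 h2] i; rewrite !mxE gt_max le_min; have /andP[-> ->] := h1 i; exact: h2.
by move=> h; split => i; have := h i; rewrite !mxE gt_max le_min;
  case/andP => /andP[h1 h2] /andP[h3 h4]; apply/andP.
Qed.

(** Balls of the row-vector norm are cubes, so the corners are found coordinate by coordinate from
    the density of the rationals. Rational corners keep the family of boxes countable. *)
Lemma rat_box_nbhs (R : realType) (n : nat) (U : set 'rV[R]_n) (x : 'rV[R]_n) :
  open U -> U x -> exists ab : 'rV[rat]_n * 'rV[rat]_n,
    box (map_mx ratr ab.1) (map_mx ratr ab.2) x /\
    box (map_mx ratr ab.1) (map_mx ratr ab.2) `<=` U.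
Proof.
move=> oU Ux; have /nbhs_ballP[e /= e0 eU] : nbhs x U by exact: open_nbhs_nbhs.
have /choice[a Ha] : forall i, exists q : rat, x ord0 i - e < ratr q < x ord0 i.
  move=> i; have : x ord0 i - e < x ord0 i by rewrite ltrBlDr ltrDl.
  by move=> /rat_in_itvoo[q]; rewrite in_itv/= => h; exists q.
have /choice[b Hb] : forall i, exists q : rat, x ord0 i < ratr q < x ord0 i + e.
  move=> i; have : x ord0 i < x ord0 i + e by rewrite ltrDl.
  by move=> /rat_in_itvoo[q]; rewrite in_itv/= => h; exists q.
exists (\row_i a i, \row_i b i); split => /=.
  by move=> i; rewrite !mxE; have /andP[_ ->] := Ha i; have /andP[/ltW -> _] := Hb i.
move=> y h; apply: eU; split => // j i; rewrite (ord1 j) /ball/=.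
have := h i; rewrite !mxE => /andP[h1 h2].
have /andP[h3 h4] := Ha i; have /andP[h5 h6] := Hb i.
by rewrite ltr_norml; apply/andP; split; lra.
Qed.

Lemma open_bigcup_box (R : realType) (n : nat) (U : set 'rV[R]_n) : open U ->
  U = \bigcup_(ab in [set ab : 'rV[rat]_n * 'rV[rat]_n |
         box (map_mx ratr ab.1) (map_mx ratr ab.2) `<=` U])
       box (map_mx ratr ab.1) (map_mx ratr ab.2).
Proof.
move=> oU; apply/seteqP; split => x.
  by move=> Ux; have [ab [h1 h2]] := rat_box_nbhs oU Ux; exists ab.
by move=> [ab /= h]; exact: h.
Qed.

Definition boxes (R : realType) (n : nat) : set (set (Rn R n)) :=
  [set A | exists a b, A = box a b].

(** An open set is the union of the rational boxes it contains, and there are only countably many of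
    these. *)
Lemma Rn_measurableE (R : realType) (n : nat) :
  @measurable _ (Rn R n) = <<s @boxes R n >>.
Proof.
apply/seteqP; split => A.
  apply: smallest_sub => [|U oU]; first exact: smallest_sigma_algebra.
  rewrite (open_bigcup_box oU).
  rewrite bigcup_mkcond.
  apply: (@countable_bigcupT_measurable _ (g_sigma_algebraType (@boxes R n))).
    exact: countableP.
  move=> ab; case: ifPn => _; last exact: measurable0.
  by apply: sub_sigma_algebra; exists (map_mx ratr ab.1), (map_mx ratr ab.2).
apply: smallest_sub => [|_ [a [b ->]]]; last exact: measurable_box.
exact: sigma_algebra_measurable.
Qed.

(** [is_lebesgue] speaks only of ordered corners; with a reversed pair the box is empty. The
    uniqueness argument needs the value on every box. *)
Lemma is_lebesgue_box (R : realType) (n : nat)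
    (lam : {measure set (Rn R n) -> \bar R}) (a b : 'rV[R]_n) : is_lebesgue lam ->
  lam (box a b) = if [forall i, a ord0 i <= b ord0 i]
                  then (\prod_(i < n) (b ord0 i - a ord0 i))%:E else 0%E.
Proof.
move=> hl; case: ifPn => [/forallP h|]; first exact: hl.
rewrite negb_forall => /existsP[i]; rewrite -ltNge => ba.
rewrite (_ : box a b = set0) ?measure0//; apply/seteqP; split => // x /(_ i).
by move=> /andP[h1 h2]; have := lt_le_trans h1 h2; rewrite ltNge (ltW ba).
Qed.

Lemma box_cover (R : realType) (n : nat) :
  \bigcup_k (box (\row__ - k%:R) (\row__ k%:R) : set (Rn R n)) = setT.
Proof.
apply/seteqP; split => // x _.
exists (Num.truncn `|x : 'rV[R]_n|).+1 => // i; rewrite !mxE.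
have xi : `|(x : 'rV[R]_n) ord0 i| < (Num.truncn `|x : 'rV[R]_n|).+1%:R.
  apply: (@le_lt_trans _ _ `|x : 'rV[R]_n|); last exact: truncnS_gt.
  by rewrite [leRHS]mx_normrE; exact: (le_bigmax _ _ (ord0, i)).
by move: xi; rewrite ltr_norml => /andP[-> /ltW].
Qed.

(* [regular] lets each distribution choose its own Lebesgue measure; this makes the
   densities of two regular distributions comparable. *)
Lemma is_lebesgue_unique (R : realType) (n : nat)
    (lam lam' : {measure set (Rn R n) -> \bar R}) :
  is_lebesgue lam -> is_lebesgue lam' ->
  forall A, measurable A -> lam A = lam' A.
Proof.
move=> hl hl' A mA.
apply: (measure_unique (@boxes R n) (fun k => box (\row__ - k%:R) (\row__ k%:R))) => //.
- exact: Rn_measurableE.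
- by move=> _ _ [a [b ->]] [c [d ->]]; rewrite setI_box; eexists; eexists.
- by move=> k; eexists; eexists.
- exact: box_cover.
- by move=> _ [a [b ->]]; rewrite !is_lebesgue_box.
- by move=> k; rewrite is_lebesgue_box//; case: ifPn; rewrite ltry.
Qed.

(** * Inner regularity and preimages under injective maps *)

(** Continuity from above. It serves to truncate a countable union, to shrink neighbourhoods of a
    sublevel set and to exhaust the space by cubes. *)
Lemma measure_shrink d (T : measurableType d) (R : realType)
    (mu : {finite_measure set T -> \bar R}) (G : (set T)^nat) :
  (forall k, measurable (G k)) -> nonincreasing_seq G -> \bigcap_k G k = set0 ->
  forall e : R, 0 < e -> exists k, (mu (G k) < e%:E)%E.
Proof.
move=> mG dG G0 e e0.
have : mu \o G @ \oo --> mu (\bigcap_n G n).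
  apply: nonincreasing_cvg_mu => //.
  - by rewrite ltey_eq fin_num_measure.
  - by rewrite G0.
rewrite G0 measure0 => /fine_cvgP[_ /cvgrPdist_lt /(_ _ e0)[N _ /(_ N)]] /=.
rewrite leqnn sub0r normrN => /(_ isT) h; exists N.
rewrite -(fineK (fin_num_measure mu (G N) (mG N))) lte_fin.
exact: le_lt_trans (ler_norm _) h.
Qed.

(* [op] plays the role of the open sets, but need only be closed under
   countable unions and finite intersections. *)
Definition sandwiched d (T : measurableType d) (R : realType)
    (op : set (set T)) (mu : {finite_measure set T -> \bar R}) : set (set T) :=
  [set D | forall e : R, 0 < e -> exists F U : set T,
    [/\ op (~` F), op U, F `<=` D, D `<=` U & (mu (U `\` F) < e%:E)%E]].

Section sandwiched_sigma_algebra.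
Context d (T : measurableType d) (R : realType).
Variables (op : set (set T)) (mu : {finite_measure set T -> \bar R}).
Hypothesis opm : op `<=` measurable.
Hypothesis op0 : op set0.
Hypothesis opT : op setT.
Hypothesis opI : setI_closed op.
Hypothesis op_bigcup : forall U : (set T)^nat, (forall k, op (U k)) -> op (\bigcup_k U k).

Let mclosed F : op (~` F) -> measurable F.
Proof. by move=> /opm/measurableC; rewrite setCK. Qed.

(** Complementation exchanges the inner and the outer set. For a countable union the gaps are chosen
    geometrically small, with sum [e / 2], and the inner union is cut to a finite one at a cost
    below [e / 2]. *)
Lemma sandwiched_sigma_algebra : sigma_algebra setT (sandwiched op mu).
Proof.
split.
- move=> e e0; exists set0, set0; split => //; rewrite ?setC0//.
  by rewrite setD0 measure0 lte_fin.
- move=> A hA e e0; have [F [U [oF oU FA AU muUF]]] := hA _ e0.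
  rewrite setTD; exists (~` U), (~` F); split => //.
  + by rewrite setCK.
  + exact: subsetC.
  + exact: subsetC.
  + by rewrite setDE setCK setIC -setDE.
- move=> D hD e e0.
  have e2k k : 0 < e / 2 / (2 ^ k.+1)%:R.
    by rewrite divr_gt0 ?divr_gt0// ltr0n expn_gt0.
  have /choice[FU hFU] : forall k, exists FU : set T * set T,
    [/\ op (~` FU.1), op FU.2, FU.1 `<=` D k, D k `<=` FU.2 &
        (mu (FU.2 `\` FU.1) < (e / 2 / (2 ^ k.+1)%:R)%:E)%E].
    by move=> k; have [F [U h]] := hD k _ (e2k k); exists (F, U).
  (* A countable union of inner sets need not have its complement in [op]; [G n] is what is lost by
     keeping the first [n] of them. *)
  pose G n := \bigcup_k (FU k).1 `\` \bigcup_(k < n) (FU k).1.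
  have mF k : measurable (FU k).1 by have [/mclosed] := hFU k.
  have mU k : measurable (FU k).2 by have [_ /opm] := hFU k.
  have mG n : measurable (G n).
    by apply: measurableD; apply: bigcup_measurable.
  have [||N hN] := measure_shrink mu mG _ _ (divr_gt0 e0 (ltr0Sn _ 1)).
  + move=> m n mn; apply/subsetPset; apply: setDS => x [k /= km Fx].
    by exists k => //=; exact: leq_trans mn.
  + by apply/seteqP; split => // x /= h; have [[k _ Fx] _] := h 0%N I;
      have [_ []] := h k.+1 I; exists k => /=.
  exists (\bigcup_(k < N) (FU k).1), (\bigcup_k (FU k).2); split.
  + rewrite bigcup_mkord; elim/big_ind : _ => [|X Y hX hY|i _].
    * by rewrite setC0.
    * by rewrite setCU; exact: opI.
    * by have [] := hFU i.
  + by apply: op_bigcup => k; have [] := hFU k.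
  + by move=> x [k _ Fx]; exists k => //; have [_ _ /(_ _ Fx)] := hFU k.
  + by move=> x [k _ Dx]; exists k => //; have [_ _ _ /(_ _ Dx)] := hFU k.
  + have sub : \bigcup_k (FU k).2 `\` \bigcup_(k < N) (FU k).1 `<=`
        \bigcup_k ((FU k).2 `\` (FU k).1) `|` G N.
      move=> x [[k _ Ux] nFx].
      have [Fx|nFkx] := pselect ((FU k).1 x); last by left; exists k.
      by right; split => //; exists k.
    apply: (@le_lt_trans _ _ (mu (\bigcup_k ((FU k).2 `\` (FU k).1) `|` G N))).
      apply: le_measure => //; rewrite inE.
        by apply: measurableD; apply: bigcup_measurable.
      by apply: measurableU => //; apply: bigcupT_measurable => k; exact: measurableD.
    apply: (@le_lt_trans _ _ (mu (\bigcup_k ((FU k).2 `\` (FU k).1)) + mu (G N))%E).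
      apply: measureU2 => //.
      by apply: bigcupT_measurable => k; exact: measurableD.
    rewrite [e in e%:E](_ : e = e / 2 + e / 2) ?EFinD; last by field.
    apply: lee_ltD => //.
      apply: fin_num_measure.
      by apply: bigcupT_measurable => k; exact: measurableD.
    apply: (@le_trans _ _ (\sum_(0 <= k <oo) mu ((FU k).2 `\` (FU k).1))%E).
      apply: measure_sigma_subadditive => //.
        by move=> k; exact: measurableD.
      by apply: bigcupT_measurable => k; exact: measurableD.
    apply: (@le_trans _ _ (\sum_(0 <= k <oo) (e / 2 / (2 ^ k.+1)%:R)%:E)%E).
      by apply: lee_nneseries => // k _; have [_ _ _ _ /ltW] := hFU k.
    by apply: epsilon_trick0; rewrite divr_ge0// ltW.
Qed.

End sandwiched_sigma_algebra.

Definition halfspaces (R : realType) (n : nat) : set (set (Rn R n)) :=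
  [set A | exists (i : 'I_n) (b : R), A = [set x | (x : 'rV[R]_n) ord0 i <= b]].

(** A box is a finite intersection of differences of halfspaces. Halfspaces are sublevel sets of a
    single continuous function, which makes them convenient generators. *)
Lemma sub_Rn_halfspaces (R : realType) (n : nat) :
  @measurable _ (Rn R n) `<=` <<s @halfspaces R n >>.
Proof.
rewrite Rn_measurableE; apply: smallest_sub => [|_ [a [b ->]]].
  exact: smallest_sigma_algebra.
have -> : box a b = \bigcap_(i in [set: 'I_n])
    ([set x : Rn R n | (x : 'rV[R]_n) ord0 i <= b ord0 i] `\`
     [set x : Rn R n | (x : 'rV[R]_n) ord0 i <= a ord0 i]).
  apply/seteqP; split => x /= h i.
    by move=> _; have /andP[h1 h2] := h i; split => //; apply/negP; rewrite -ltNge.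
  by have [h1 /negP] := h i I; rewrite -ltNge => ->.
apply: (@fin_bigcap_measurable _ (g_sigma_algebraType (@halfspaces R n))) => [|i _].
  exact: finite_finset.
by apply: measurableD; apply: sub_sigma_algebra; eexists; eexists.
Qed.

(** Measurability refers to the product sigma-algebra and openness to the product topology;
    requiring both avoids comparing the two structures. *)
Definition prod_open (R : realType) (m n : nat) : set (set (Rn R m * Rn R n)%type) :=
  [set U : set (Rn R m * Rn R n)%type | measurable U /\ open (U : set ('rV[R]_m * 'rV[R]_n))].

(** The sublevel set is its own inner approximation, and the open sets [h z < b + 1 / (k + 1)]
    decrease to it. *)
Lemma sandwiched_sublevel (R : realType) (m n : nat)
    (mu : {finite_measure set (Rn R m * Rn R n)%type -> \bar R})
    (h : 'rV[R]_m * 'rV[R]_n -> R) (b : R) :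
  continuous h -> measurable_fun [set: (Rn R m * Rn R n)%type] (h : (Rn R m * Rn R n)%type -> R) ->
  sandwiched (@prod_open R m n) mu [set z | h z <= b].
Proof.
move=> /continuousP ch mh e e0.
have oph (c : R) : @prod_open R m n [set z | h z < c].
  have -> : [set z : (Rn R m * Rn R n)%type | h z < c] = h @^-1` `]-oo, c[%classic.
    by apply/seteqP; split => z; rewrite /= in_itv.
  split; last by apply: ch; exact: interval_open.
  by rewrite -[X in measurable X]setTI; exact: mh.
have ophC : @prod_open R m n (~` [set z | h z <= b]).
  have -> : ~` [set z : (Rn R m * Rn R n)%type | h z <= b] = h @^-1` `]b, +oo[%classic.
    apply/seteqP; split => z /=; rewrite in_itv/= andbT ltNge => /negP//.
  split; last by apply: ch; exact: interval_open.
  by rewrite -[X in measurable X]setTI; exact: mh.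
have mF : measurable [set z : (Rn R m * Rn R n)%type | h z <= b].
  by have [/measurableC + _] := ophC; rewrite setCK.
pose G k := [set z : (Rn R m * Rn R n)%type | h z < b + k.+1%:R^-1] `\` [set z | h z <= b].
have [| | |k hk] := measure_shrink mu (G := G) _ _ _ e0.
- by move=> k; apply: measurableD => //; have [] := oph (b + k.+1%:R^-1).
- move=> k l kl; apply/subsetPset; apply: setSD => z /= /lt_le_trans; apply.
  by rewrite lerD2l lef_pV2 ?posrE// ler_nat.
- apply/seteqP; split => // z /= hz.
  have [_ /negP] := hz 0%N I; rewrite -ltNge -subr_gt0 => h0.
  (* At this index [1 / (k + 1) <= h z - b], so [z] has already left the neighbourhood. *)
  have [+ _] := hz (Num.truncn (h z - b)^-1) I.
  apply/negP; rewrite -leNgt -lerBrDl -[leRHS]invrK lef_pV2 ?posrE ?invr_gt0//.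
  exact/ltW/truncnS_gt.
- exists [set z | h z <= b], [set z | h z < b + k.+1%:R^-1]; split => //.
  by move=> z /= /le_lt_trans; apply; rewrite ltrDl.
Qed.

(** The product sigma-algebra is generated by preimages under the two projections. For each
    projection, the sets with sandwiched preimage form a sigma-algebra that contains the
    halfspaces. *)
Lemma sandwiched_prod (R : realType) (m n : nat)
    (mu : {finite_measure set (Rn R m * Rn R n)%type -> \bar R}) :
  measurable `<=` sandwiched (@prod_open R m n) mu.
Proof.
have sS : sigma_algebra setT (sandwiched (@prod_open R m n) mu).
  apply: sandwiched_sigma_algebra.
  - by move=> U [].
  - by split; [exact: measurable0|exact: open0].
  - by split; [exact: measurableT|exact: openT].
  - by move=> U V [mU oU] [mV oV]; split; [exact: measurableI|exact: openI].
  - move=> U hU; split; first by apply: bigcupT_measurable => k; have [] := hU k.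
    by apply: bigcup_open => k _; have [] := hU k.
have [S0 SC SU] := sS.
apply: smallest_sub => //; rewrite subUset; split => _ [A mA <-]; rewrite setTI.
- have : (<<s @halfspaces R m >>) A by exact: sub_Rn_halfspaces.
  move: A {mA}; apply: (@smallest_sub _ _ _ [set A | sandwiched (@prod_open R m n) mu (fst @^-1` A)]).
    split => /=.
    + by rewrite preimage_set0.
    + by move=> A hA; exact: (SC _ hA).
    + by move=> A hA; rewrite preimage_bigcup; exact: SU.
  move=> _ [i [b ->]].
  apply: (@sandwiched_sublevel R m n mu (fun z => z.1 ord0 i)).
  + by move=> z; apply: (@continuous_comp _ _ _ fst (fun x : 'rV[R]_m => x ord0 i)); [exact: cvg_fst|exact: coord_continuous].
  + by apply: (measurableT_comp (@measurable_coord R m i)); exact: measurable_fst.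
- have : (<<s @halfspaces R n >>) A by exact: sub_Rn_halfspaces.
  move: A {mA}; apply: (@smallest_sub _ _ _ [set A | sandwiched (@prod_open R m n) mu (snd @^-1` A)]).
    split => /=.
    + by rewrite preimage_set0.
    + by move=> A hA; exact: (SC _ hA).
    + by move=> A hA; rewrite preimage_bigcup; exact: SU.
  move=> _ [i [b ->]].
  apply: (@sandwiched_sublevel R m n mu (fun z => z.2 ord0 i)).
  + by move=> z; apply: (@continuous_comp _ _ _ snd (fun x : 'rV[R]_n => x ord0 i)); [exact: cvg_snd|exact: coord_continuous].
  + by apply: (measurableT_comp (@measurable_coord R n i)); exact: measurable_snd.
Qed.

Definition cube (R : realType) (n k : nat) : set 'rV[R]_n :=
  [set x | forall i, x ord0 i \in `[- k%:R, k%:R]].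

Lemma cube_compact (R : realType) (n k : nat) : compact (@cube R n k).
Proof.
have h : forall i : 'I_n, compact (`[- k%:R, k%:R]%classic : set R) by move=> i; exact: segment_compact.
have := @rV_compact R n (fun=> `[- k%:R, k%:R]%classic) h. exact.
Qed.

Lemma rV_hausdorff (R : realType) (n : nat) : hausdorff_space 'rV[R]_n.
Proof. exact: norm_hausdorff. Qed.

Lemma measurable_cube (R : realType) (n k : nat) : measurable (@cube R n k : set (Rn R n)).
Proof.
apply: measurable_closed; apply: compact_closed; last exact: cube_compact.
exact: rV_hausdorff.
Qed.

(** A closed inner approximation is intersected with a large product of cubes; each of the two
    operations loses less than [e / 2]. *)
Lemma inner_regular_prod (R : realType) (m n : nat)
    (mu : {finite_measure set (Rn R m * Rn R n)%type -> \bar R})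
    (D : set (Rn R m * Rn R n)%type) (e : R) : measurable D -> 0 < e ->
  exists K : set (Rn R m * Rn R n)%type,
    [/\ compact (K : set ('rV[R]_m * 'rV[R]_n)), measurable K, K `<=` D &
        (mu (D `\` K) < e%:E)%E].
Proof.
move=> mD e0.
have [F [U [[mFC oFC] [mU _] FD DU muUF]]] := sandwiched_prod mu mD (divr_gt0 e0 (ltr0Sn _ 1)).
have mF : measurable F by rewrite -(setCK F); exact: measurableC.
pose Q k : set (Rn R m * Rn R n)%type := @cube R m k `*` @cube R n k.
have mQ k : measurable (Q k) by apply: measurableX; exact: measurable_cube.
have [| | |k hk] := measure_shrink mu (G := fun k => ~` Q k) _ _ _ (divr_gt0 e0 (ltr0Sn _ 1)).
- by move=> k; exact: measurableC.
- move=> k l kl; apply/subsetPset; apply: subsetC => -[x y] [/= Qx Qy].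
  have kl' : k%:R <= l%:R :> R by rewrite ler_nat.
  by split => i /=; [have := Qx i|have := Qy i]; rewrite !in_itv/=; lra.
- apply/seteqP; split => // -[x y] h; exfalso.
  apply: (h (Num.truncn `|(x, y) : 'rV[R]_m * 'rV[R]_n|).+1 I).
  have xy : `|(x, y) : 'rV[R]_m * 'rV[R]_n| < (Num.truncn `|(x, y) : 'rV[R]_m * 'rV[R]_n|).+1%:R by exact: truncnS_gt.
  split => i /=; rewrite in_itv/= -ler_norml; apply: le_trans (ltW xy).
  + by rewrite prod_normE le_max; apply/orP; left; rewrite [leRHS]mx_normrE; exact: (le_bigmax _ _ (ord0, i)).
  + by rewrite prod_normE le_max; apply/orP; right; rewrite [leRHS]mx_normrE; exact: (le_bigmax _ _ (ord0, i)).
exists (F `&` Q k); split.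
- rewrite setIC; apply: compact_closedI; first by apply: compact_setX; exact: cube_compact.
  by rewrite -(setCK F); exact: open_closedC.
- exact: measurableI.
- by apply: subset_trans FD => z [].
- apply: (@le_lt_trans _ _ (mu ((U `\` F) `|` ~` Q k))).
    apply: le_measure; rewrite ?inE.
    + by apply: measurableD => //; exact: measurableI.
    + by apply: measurableU; [exact: measurableD|exact: measurableC].
    + move=> z [Dz nz]; have [Fz|nFz] := pselect (F z); last by left; split => //; exact: DU.
      by right => Qz; apply: nz.
  apply: (@le_lt_trans _ _ (mu (U `\` F) + mu (~` Q k))%E).
    by apply: measureU2; [exact: measurableD|exact: measurableC].
  rewrite [e in e%:E](_ : e = e / 2 + e / 2) ?EFinD; last by field.
  by apply: lteD.
Qed.

(** * Supports of Borel measures *)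

Lemma msupport_closed (R : realType) (n : nat) (mu : set (Rn R n) -> \bar R) :
  closed (msupport mu).
Proof.
move=> x hx U oU Ux; have [y [hy Uy]] := hx U (open_nbhs_nbhs (conj oU Ux)).
exact: hy.
Qed.

(** Each point off the support has a null open neighbourhood, hence lies in a null rational box, and
    countably many null boxes have a null union. *)
Lemma measure_msupportC (R : realType) (n : nat)
    (mu : {measure set (Rn R n) -> \bar R}) :
  mu (~` (msupport mu : set (Rn R n))) = 0%E.
Proof.
pose B (ab : 'rV[rat]_n * 'rV[rat]_n) : set (Rn R n) :=
  box (map_mx ratr ab.1) (map_mx ratr ab.2).
(* Null rational boxes listed by their codes; every other code stands for the empty set. *)
pose F k : set (Rn R n) := if unpickle k is Some ab then
  (if mu (B ab) == 0%E then B ab else set0) else set0.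
have sub : ~` (msupport mu : set (Rn R n)) `<=` \bigcup_k F k.
  move=> x /existsNP[U] /not_implyP[oU] /not_implyP[Ux] /negP.
  rewrite -leNgt => muU0.
  have [ab [xab abU]] := rat_box_nbhs oU Ux.
  exists (pickle ab) => //; rewrite /F pickleK.
  suff -> : mu (B ab) == 0%E by [].
  rewrite eq_le measure_ge0 andbT; apply: le_trans muU0.
  apply: le_measure => //; rewrite inE; first exact: measurable_box.
  exact: measurable_open.
have neg : mu.-negligible (\bigcup_k F k).
  apply: negligible_bigcup => k; rewrite /F.
  case: unpickle => [ab|]; last exact: negligible_set0.
  case: eqP => [h|_]; last exact: negligible_set0.
  by apply/negligibleP => //; exact: measurable_box.
apply/negligibleP; last exact: negligibleS neg.
apply: measurableC; apply: measurable_closed; exact: msupport_closed.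
Qed.

Lemma measure_eq_on_msupport (R : realType) (n : nat)
    (mu : {measure set (Rn R n) -> \bar R}) (M A : set (Rn R n)) :
  measurable M -> measurable A -> msupport mu `<=` M -> mu (A `&` M) = mu A.
Proof.
move=> mM mA sM; apply/eqP; rewrite eq_le; apply/andP; split.
  by apply: le_measure; rewrite ?inE//; exact: measurableI.
have mMC := measurableC (measurable_closed (@msupport_closed R n mu)).
apply: (@le_trans _ _ (mu (A `&` M `|` ~` (msupport mu : set (Rn R n))))).
  apply: le_measure; rewrite ?inE//; first by apply: measurableU => //; exact: measurableI.
  move=> x Ax; have [Mx|nMx] := pselect (M x); first by left.
  by right => /sM.
apply: (le_trans (measureU2 _ _ _)) => //; first exact: measurableI.
by rewrite [X in (_ + X)%E]measure_msupportC adde0.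
Qed.

(* The image of a Borel set under an injective Borel map need not be handled by
   descriptive set theory: up to measure [e], a Borel part of the graph is
   compact, and then so is its projection to the codomain. *)
Lemma approx_by_preimage (R : realType) (m n : nat)
    (mu nu : probability (Rn R m) R) (f : Rn R m -> Rn R n) (A : set (Rn R m)) (e : R) :
  measurable_fun [set: Rn R m] f ->
  {in msupport mu `|` msupport nu &, injective f} ->
  measurable A -> 0 < e ->
  exists B : set (Rn R n), [/\ measurable B,
    (mu A <= mu (f @^-1` B) + e%:E)%E & (nu (f @^-1` B) <= nu A)%E].
Proof.
move=> mf injf mA e0.
pose M : set (Rn R m) := msupport mu `|` msupport nu.
have mM : measurable M.
  by apply: measurableU; apply: measurable_closed; exact: msupport_closed.
pose gr (x : Rn R m) : (Rn R m * Rn R n)%type := (x, f x).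
have mgr : measurable_fun [set: Rn R m] gr by exact: measurable_fun_pair.
(* The graph of [f] over the part of [A] in the supports, cut out by coordinate differences so that
   its measurability reduces to that of real functions. *)
pose D : set (Rn R m * Rn R n)%type :=
  [set z | (A `&` M) z.1] `&` \bigcap_(i in [set: 'I_n])
    ((fun z => (f z.1 : 'rV[R]_n) ord0 i - (z.2 : 'rV[R]_n) ord0 i) @^-1` [set 0]).
have mD : measurable D.
  apply: measurableI.
    rewrite -[X in measurable X]setTI; apply: measurable_fst => //.
    exact: measurableI.
  apply: fin_bigcap_measurable => [|i _]; first exact: finite_finset.
  rewrite -[X in measurable X]setTI.
  have : measurable_fun [set: (Rn R m * Rn R n)%type]
    (fun z => (f z.1 : 'rV[R]_n) ord0 i - (z.2 : 'rV[R]_n) ord0 i).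
    apply: measurable_funB.
      apply: (measurableT_comp (@measurable_coord R n i)).
      by apply: (measurableT_comp mf); exact: measurable_fst.
    by apply: (measurableT_comp (@measurable_coord R n i)); exact: measurable_snd.
  by apply => //; exact: measurable_set1.
pose gmu : {mfun Rn R m >-> (Rn R m * Rn R n)%type} :=
  HB.pack gr (isMeasurableFun.Build _ _ _ _ gr mgr).
(* The image of [mu] under the graph map, for which [D] has the mass [mu A]. *)
pose rho : {finite_measure set (Rn R m * Rn R n)%type -> \bar R} := distribution mu gmu.
have [K [cK mK KD hK]] := inner_regular_prod rho mD e0.
pose B : set (Rn R n) := snd @` K.
have cB : compact (B : set 'rV[R]_n).
  apply: (@continuous_compact ('rV[R]_m * 'rV[R]_n)%type 'rV[R]_n snd) => //.
  by apply: continuous_subspaceT => z; exact: cvg_snd.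
have mB : measurable B.
  by apply: measurable_closed; apply: compact_closed cB; exact: rV_hausdorff.
have mfB : measurable (f @^-1` B) by rewrite -[X in measurable X]setTI; exact: mf.
have KDE z : K z -> [/\ A z.1, M z.1 & f z.1 = z.2].
  move=> /KD[[Az Mz] h]; split => //; apply/rowP => i.
  by apply/eqP; rewrite -subr_eq0; apply/eqP; exact: h.
exists B; split => //.
- have -> : mu A = rho D.
    rewrite -(@measure_eq_on_msupport _ _ mu M)//; last by move=> x; left.
    rewrite /rho/=/distribution /pushforward; congr (mu _).
    apply/seteqP; split => x /=; last by move=> [].
    by move=> [Ax Mx]; split => // i _ /=; rewrite subrr.
  apply: (@le_trans _ _ (rho K + rho (D `\` K))%E).
    rewrite -[X in (rho X <= _)%E](@setDUK _ K D)//.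
    by apply: measureU2 => //; exact: measurableD.
  apply: leeD; last exact: ltW.
  rewrite /rho/=/distribution /pushforward; apply: le_measure; rewrite ?inE//.
    by rewrite -[X in measurable X]setTI; exact: (mgr measurableT K mK).
  by move=> x /= Kx; exists (gr x).
- rewrite -(@measure_eq_on_msupport _ _ nu M)//; last by move=> x; right.
  apply: le_measure; rewrite ?inE//; first exact: measurableI.
  move=> x [[z Kz /= zfx] Mx]; have [Az Mz fz] := KDE _ Kz.
  (* Injectivity enters here: both points lie in the supports and have the same image, so [x]
     inherits membership in [A]. *)
  suff -> : x = z.1 by [].
  by apply: injf; rewrite ?inE// fz.
Qed.

(** * Total variation and the symmetrised divergence *)

Section density.
Context d (T : measurableType d) (R : realType).
Variables (lam : {sigma_finite_measure set T -> \bar R}).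
Variables (P : {finite_measure set T -> \bar R}) (p : T -> R).
Hypothesis mp : measurable_fun [set: T] p.
Hypothesis p0 : forall x, 0 <= p x.
Hypothesis Pp : forall A, measurable A -> P A = (\int[lam]_(x in A) (p x)%:E)%E.

Let lam_p_integrable : lam.-integrable [set: T] (EFin \o p).
Proof.
apply/integrableP; split; first exact/measurable_EFinP.
under eq_integral do rewrite /= ger0_norm//.
by rewrite -Pp// ltey_eq fin_num_measure.
Qed.

(** [p] and the Radon-Nikodym derivative of [P] have the same integral over every measurable set,
    hence agree almost everywhere, and the change of variables for the latter applies. *)
Lemma integral_density (f : T -> \bar R) : P.-integrable [set: T] f ->
  (\int[P]_x f x = \int[lam]_x (f x * (p x)%:E))%E.
Proof.
move=> Pf.
have Plam : charge_of_finite_measure P `<< lam.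
  apply/null_content_dominatesP => A mA lamA0.
  rewrite [LHS]Pp//; apply: null_set_integral => //.
  by apply: measurable_funTS; exact/measurable_EFinP.
rewrite -(Radon_Nikodym_change_of_variables Plam)//.
have mf := measurable_int _ Pf.
apply: ae_eq_integral => //.
- exact: emeasurable_funM.
- by apply: emeasurable_funM => //; exact/measurable_EFinP.
- apply: ae_eqe_mul2l; apply: integral_ae_eq => //.
  + exact: (Radon_Nikodym_integrable Plam).
  + exact/measurable_EFinP.
  + by move=> A _ mA; rewrite -Radon_Nikodym_integral// -Pp.
Qed.

Lemma integrable_density (f : T -> \bar R) : P.-integrable [set: T] f ->
  lam.-integrable [set: T] (fun x => f x * (p x)%:E)%E.
Proof.
move=> Pf; apply/integrableP; split.
  apply: emeasurable_funM; first exact: measurable_int Pf.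
  exact/measurable_EFinP.
have /integrableP[_] := Pf; rewrite (integral_density (integrable_abse Pf)).
rewrite (_ : (\int[lam]_x _ = \int[lam]_x `|f x * (p x)%:E|)%E)//.
by apply: eq_integral => x _; rewrite abseM [in RHS](@gee0_abs _ (p x)%:E)// lee_fin.
Qed.

End density.

Lemma le_integral_density d (T : measurableType d) (R : realType)
    (lam : {sigma_finite_measure set T -> \bar R})
    (P Q : {finite_measure set T -> \bar R}) (p q u v : T -> R) :
  measurable_fun [set: T] p -> measurable_fun [set: T] q ->
  (forall x, 0 <= p x) -> (forall x, 0 <= q x) ->
  (forall A, measurable A -> P A = (\int[lam]_(x in A) (p x)%:E)%E) ->
  (forall A, measurable A -> Q A = (\int[lam]_(x in A) (q x)%:E)%E) ->
  P.-integrable [set: T] (EFin \o u) -> Q.-integrable [set: T] (EFin \o v) ->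
  (forall x, u x * p x <= v x * q x) ->
  \int[P]_x u x <= \int[Q]_x v x.
Proof.
move=> mp mq p0 q0 Pp Qq Pu Qv upvq.
apply: fine_le; try exact: integrable_fin_num.
rewrite (integral_density mp Pp)// (integral_density mq Qq)//.
apply: le_integral => //.
- exact: (integrable_density mp p0 Pp Pu).
- exact: (integrable_density mq q0 Qq Qv).
- by move=> x _; rewrite -!EFinM lee_fin.
Qed.

(* With [s] the sign that is [1] on [B] and [-1] off it, the weighted arithmetic-geometric
   inequality gives [s (p - q) <= t/2 (p + q) + 1/(2t) (p - q) (ln p - ln q)];
   collecting the multiples of [p] and of [q] avoids integrating against [lam]. *)
Lemma prob_diff_le_jeffreys d (T : measurableType d) (R : realType)
    (lam : {sigma_finite_measure set T -> \bar R})
    (P Q : probability T R) (p q : T -> R) (B : set T) (t : R) :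
  measurable_fun [set: T] p -> measurable_fun [set: T] q ->
  (forall x, 0 < p x) -> (forall x, 0 < q x) ->
  (forall A, measurable A -> P A = (\int[lam]_(x in A) (p x)%:E)%E) ->
  (forall A, measurable A -> Q A = (\int[lam]_(x in A) (q x)%:E)%E) ->
  let phi := fun x => ln (p x) - ln (q x) in
  P.-integrable [set: T] (EFin \o phi) -> Q.-integrable [set: T] (EFin \o phi) ->
  measurable B -> 0 < t ->
  fine (P B) - fine (Q B) <= t / 2 + t^-1 / 4 * (\int[P]_x phi x - \int[Q]_x phi x).
Proof.
move=> mp mq p0 q0 Pp Qq phi Pphi Qphi mB t0.
pose s : T -> R := fun x => 2 * \1_B x - 1.
have iB (mu : probability T R) : mu.-integrable [set: T] (EFin \o (\1_B : T -> R)).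
  by apply: integrable_indic => //; rewrite ltey_eq fin_num_measure.
have icst (mu : probability T R) (k : R) : mu.-integrable [set: T] (EFin \o cst k).
  by apply: finite_measure_integrable_cst.
have is2 (mu : probability T R) : mu.-integrable [set: T] (EFin \o (fun x => 2 * \1_B x)).
  have := integrableZl measurableT 2 (iB mu); apply: eq_integrable => // x _.
have is_ (mu : probability T R) : mu.-integrable [set: T] (EFin \o s).
  have := integrableB measurableT (is2 mu) (icst mu 1); exact: eq_integrable.
have sE (mu : probability T R) : \int[mu]_x s x = 2 * fine (mu B) - 1.
  rewrite (RintegralB measurableT (is2 mu) (icst mu 1)).
  rewrite (RintegralZl _ measurableT (iB mu)) Rintegral_cst//= probability_setT mulr1.
  by rewrite /Rintegral integral_indic// setIT.
have iphi (mu : probability T R) : mu.-integrable [set: T] (EFin \o phi) ->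
    mu.-integrable [set: T] (EFin \o (fun x => t^-1 / 2 * phi x)).
  by move=> h; have := integrableZl measurableT (t^-1 / 2) h; exact: eq_integrable.
have isphi (mu : probability T R) : mu.-integrable [set: T] (EFin \o phi) ->
    mu.-integrable [set: T] (EFin \o (fun x => s x - t^-1 / 2 * phi x)).
  move=> h; have := integrableB measurableT (is_ mu) (iphi mu h).
  exact: eq_integrable.
(* For these two functions the pointwise hypothesis is the inequality for [s (p - q)] with the
   multiples of [p] on the left and those of [q] on the right. *)
have := @le_integral_density _ _ _ lam P Q p q
  (fun x => s x - t^-1 / 2 * phi x - t / 2) (fun x => s x - t^-1 / 2 * phi x + t / 2)
  mp mq (fun x => ltW (p0 x)) (fun x => ltW (q0 x)) Pp Qq.
have -> : \int[P]_x (s x - t^-1 / 2 * phi x - t / 2) =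
    2 * fine (P B) - 1 - t^-1 / 2 * \int[P]_x phi x - t / 2.
  rewrite (RintegralB measurableT (isphi P Pphi) (icst P (t / 2))).
  rewrite (RintegralB measurableT (is_ P) (iphi P Pphi)).
  by rewrite (RintegralZl _ measurableT Pphi) sE Rintegral_cst//= probability_setT mulr1.
have -> : \int[Q]_x (s x - t^-1 / 2 * phi x + t / 2) =
    2 * fine (Q B) - 1 - t^-1 / 2 * \int[Q]_x phi x + t / 2.
  rewrite (RintegralD measurableT (isphi Q Qphi) (icst Q (t / 2))).
  rewrite (RintegralB measurableT (is_ Q) (iphi Q Qphi)).
  by rewrite (RintegralZl _ measurableT Qphi) sE Rintegral_cst//= probability_setT mulr1.
move=> h; suff : 2 * fine (P B) - 1 - t^-1 / 2 * \int[P]_x phi x - t / 2 <=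
    2 * fine (Q B) - 1 - t^-1 / 2 * \int[Q]_x phi x + t / 2 by lra.
apply: h.
- have := integrableB measurableT (isphi P Pphi) (icst P (t / 2)).
  exact: eq_integrable.
- have := integrableD measurableT (isphi Q Qphi) (icst Q (t / 2)).
  exact: eq_integrable.
- move=> x; have := normB_amgm t0 (p0 x) (q0 x); rewrite -/(phi x).
  have : s x * (p x - q x) <= `|p x - q x|.
    rewrite /s indicE; case: (x \in B); rewrite /= ?mulr1n ?mulr0n.
      by have := ler_norm (p x - q x); lra.
    by have := ler_norm (- (p x - q x)); rewrite normrN; lra.
  lra.
Qed.

(** * Log-densities with gradient of linear growth *)

Lemma deriveE_grad (R : realType) (n : nat) (F : 'rV[R]_n -> R) (z v : 'rV[R]_n) :
  differentiable F z -> 'D_v F z = \sum_(i < n) v ord0 i * grad F z ord0 i.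
Proof.
move=> dF; rewrite deriveE// [in LHS](row_sum_delta v) linear_sum/=.
by apply: eq_bigr => i _; rewrite linearZ/= mxE deriveE.
Qed.

(** The difference quotient along the line is literally the directional one of [F], so no chain rule
    is involved. *)
Lemma is_derive_line (R : realType) (n : nat) (F : 'rV[R]_n -> R) (y v : 'rV[R]_n) (t : R) :
  differentiable F (y + t *: v) ->
  is_derive t 1 (fun s : R => F (y + s *: v)) ('D_v F (y + t *: v)).
Proof.
move=> dF.
have E : (fun h : R => h^-1 *: (((fun s : R => F (y + s *: v)) \o shift t) (h *: 1) -
      F (y + t *: v))) =
    (fun h : R => h^-1 *: ((F \o shift (y + t *: v)) (h *: v) - F (y + t *: v))).
  apply/funext => h /=; congr (_ *: (F _ - _)).
  by rewrite [h *: 1]mulr1 scalerDl addrCA.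
have : derivable F (y + t *: v) v by exact: diff_derivable.
by rewrite /derivable -E => dg; apply: DeriveDef => //; rewrite /derive E.
Qed.

(** Mean value theorem on the segment from [y] to [x]: the intermediate point is a convex
    combination, so its norm is at most [enorm x + enorm y]. *)
Lemma norm_diff_le_of_grad (R : realType) (n : nat) (F : 'rV[R]_n -> R) (c1 c2 : R)
    (x y : 'rV[R]_n) :
  0 <= c1 -> (forall z, differentiable F z) ->
  (forall z, enorm (grad F z) <= c1 * enorm z + c2) ->
  `|F x - F y| <= (c1 * (enorm x + enorm y) + c2) * enorm (x - y).
Proof.
move=> c10 dF gF; pose v := x - y.
pose g := fun s : R => F (y + s *: v).
have dg (t : R) : is_derive t 1 g ('D_v F (y + t *: v)) by exact: is_derive_line.
have [|t] := @MVT_segment R g (fun t => 'D_v F (y + t *: v)) 0 1 ler01 (fun t _ => dg t).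
  apply: continuous_subspaceT => t.
  by apply/differentiable_continuous/derivable1_diffP; exact: ex_derive.
rewrite in_itv/= => /andP[t0 t1].
have yv : y + v = x by rewrite /v addrC subrK.
rewrite /g scale1r scale0r addr0 subr0 mulr1 yv => ->.
rewrite deriveE_grad//; set z := y + _; set s := \sum_(i < n) _.
have zxy : enorm z <= enorm x + enorm y.
  have -> : z = t *: x + (1 - t) *: y.
    by rewrite /z scalerBr scalerBl scale1r; rewrite addrCA addrA addrC.
  apply: (le_trans (enormD _ _)); rewrite !enormZ !ger0_norm ?subr_ge0//.
  by apply: lerD; rewrite ler_piMl ?enorm_ge0// lerBlDr lerDl.
have h1 : s <= enorm (x - y) * enorm (grad F z) by exact: sum_mul_le_enorm.
have h2 : - s <= enorm (x - y) * enorm (grad F z).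
  have := sum_mul_le_enorm (- (x - y)) (grad F z).
  rewrite -[X in enorm X]scaleN1r enormZ normrN1 mul1r; apply: le_trans.
  by rewrite -sumrN; apply: ler_sum => i _; rewrite [(- (x - y)) _ _]mxE mulNr.
apply: (@le_trans _ _ (enorm (x - y) * enorm (grad F z))).
  by rewrite ler_norml h1 andbT lerNl.
rewrite mulrC ler_wpM2r ?enorm_ge0//; apply: (le_trans (gF z)).
by rewrite lerD2r ler_wpM2l.
Qed.

(** Passing from base 2 to the natural logarithm multiplies by [ln 2 <= 1], so the constants survive
    unchanged. *)
Lemma ln_diff_le_of_grad_log2 (R : realType) (n : nat) (p : 'rV[R]_n -> R) (c1 c2 : R)
    (x y : 'rV[R]_n) :
  0 <= c1 -> 0 <= c2 -> (forall z, 0 < p z) -> (forall z, differentiable p z) ->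
  (forall z, enorm (grad (fun w => log2 (p w)) z) <= c1 * enorm z + c2) ->
  `|ln (p x) - ln (p y)| <= (c1 * (enorm x + enorm y) + c2) * enorm (x - y).
Proof.
move=> c10 c20 p0 dp gp.
have l2 : 0 < ln (2 : R) by rewrite ln_gt0// ltr1n.
have l21 : ln (2 : R) <= 1.
  have : ln (1 + 1 : R) <= 1 by apply: le_ln1Dx; lra.
  by rewrite (_ : 1 + 1 = 2 :> R).
have dlog z : differentiable (fun w => log2 (p w)) z.
  have -> : (fun w => log2 (p w)) = (fun s : R => s * (ln 2)^-1) \o (@ln R) \o p.
    exact/funext.
  apply: differentiable_comp => //; apply: differentiable_comp.
    by apply/derivable1_diffP; apply: ex_derive; exact: is_derive1_ln.
  exact: differentiableM.
have := norm_diff_le_of_grad x y c10 dlog gp.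
rewrite /log2 -mulrBl normrM (ger0_norm (ltW (_ : 0 < (ln 2)^-1))) ?invr_gt0//.
rewrite ler_pdivrMr// => /le_trans; apply.
by rewrite ler_piMr// mulr_ge0 ?enorm_ge0// addr_ge0// mulr_ge0// addr_ge0 ?enorm_ge0.
Qed.

(** * Couplings and the Wasserstein distance *)

Lemma integrableM_sqr d (T : measurableType d) (R : realType)
    (mu : {measure set T -> \bar R}) (X Y : T -> R) :
  measurable_fun [set: T] X -> measurable_fun [set: T] Y ->
  mu.-integrable [set: T] (fun x => (X x ^+ 2)%:E) ->
  mu.-integrable [set: T] (fun x => (Y x ^+ 2)%:E) ->
  mu.-integrable [set: T] (fun x => (X x * Y x)%:E).
Proof.
move=> mX mY iX iY.
apply: (le_integrable measurableT _ _ (integrableD measurableT iX iY)).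
  by apply/measurable_EFinP; exact: measurable_funM.
move=> x _; rewrite -EFinD !abse_EFin lee_fin.
rewrite (ger0_norm (addr_ge0 (sqr_ge0 _) (sqr_ge0 _))) normrM.
rewrite -(real_normK (num_real (X x))) -(real_normK (num_real (Y x))).
have := sqr_ge0 (`|X x| - `|Y x|); have := normr_ge0 (X x); have := normr_ge0 (Y x).
nra.
Qed.

(** As for finite sums, with [2 X Y <= t X^2 + Y^2 / t] integrated for every [t > 0]. *)
Lemma Rintegral_cauchy_schwarz d (T : measurableType d) (R : realType)
    (mu : {measure set T -> \bar R}) (X Y : T -> R) :
  measurable_fun [set: T] X -> measurable_fun [set: T] Y ->
  (forall x, 0 <= X x) -> (forall x, 0 <= Y x) ->
  mu.-integrable [set: T] (fun x => (X x ^+ 2)%:E) ->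
  mu.-integrable [set: T] (fun x => (Y x ^+ 2)%:E) ->
  \int[mu]_x (X x * Y x) <=
    Num.sqrt (\int[mu]_x (X x ^+ 2)) * Num.sqrt (\int[mu]_x (Y x ^+ 2)).
Proof.
move=> mX mY X0 Y0 iX iY.
have iXY := integrableM_sqr mX mY iX iY.
have IXY0 : 0 <= \int[mu]_x (X x * Y x).
  by apply: Rintegral_ge0 => x _; rewrite mulr_ge0.
have IX0 : 0 <= \int[mu]_x (X x ^+ 2) by apply: Rintegral_ge0 => x _; exact: sqr_ge0.
have IY0 : 0 <= \int[mu]_x (Y x ^+ 2) by apply: Rintegral_ge0 => x _; exact: sqr_ge0.
rewrite -sqrtrM// -(ger0_norm IXY0) -sqrtr_sqr ler_wsqrtr//.
suff : (2 * \int[mu]_x (X x * Y x)) ^+ 2 <=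
    4 * (\int[mu]_x (X x ^+ 2)) * (\int[mu]_x (Y x ^+ 2)).
  by rewrite exprMn -natrX -mulrA ler_pM2l.
apply: sqr_le_of_amgm => //; first by rewrite mulr_ge0.
move=> t t0.
have itX : mu.-integrable [set: T] (EFin \o (fun x => t * X x ^+ 2)).
  by have := integrableZl measurableT t iX; exact: eq_integrable.
have itY : mu.-integrable [set: T] (EFin \o (fun x => t^-1 * Y x ^+ 2)).
  by have := integrableZl measurableT t^-1 iY; exact: eq_integrable.
rewrite -(RintegralZl _ measurableT iX) -(RintegralZl _ measurableT iY).
rewrite -(RintegralZl _ measurableT iXY) -(RintegralD measurableT itX itY).
apply: le_Rintegral => //.
- by have := integrableZl measurableT 2 iXY; exact: eq_integrable.
- by have := integrableD measurableT itX itY; exact: eq_integrable.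
move=> x _; rewrite -subr_ge0.
have -> : t * X x ^+ 2 + t^-1 * Y x ^+ 2 - 2 * (X x * Y x) = (t * X x - Y x) ^+ 2 / t.
  by field; rewrite gt_eqF.
by rewrite divr_ge0 ?sqr_ge0// ltW.
Qed.

(** Only the coordinates are asked to be measurable, so that the difference of the two projections
    of a coupling is covered. *)
Lemma measurable_enorm (R : realType) (n : nat) d (T : measurableType d)
    (h : T -> 'rV[R]_n) :
  (forall i, measurable_fun [set: T] (fun t => h t ord0 i)) ->
  measurable_fun [set: T] (fun t => enorm (h t)).
Proof.
move=> mh; apply: (measurableT_comp (continuous_measurable_fun (@sqrt_continuous R))).
by apply: measurable_sum => i; exact: measurable_funX.
Qed.

Lemma is_lebesgue_sigma_finite (R : realType) (n : nat)
    (lam : {measure set (Rn R n) -> \bar R}) :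
  is_lebesgue lam -> sigma_finite [set: Rn R n] lam.
Proof.
move=> hl; exists (fun k => box (\row__ - k%:R) (\row__ k%:R)); first by rewrite box_cover.
move=> k; split; first exact: measurable_box.
by rewrite is_lebesgue_box//; case: ifPn; rewrite ltry.
Qed.

Section coupling.
Context (R : realType) (n : nat) (c1 c2 : R) (P Q : probability (Rn R n) R).
Hypotheses (c10 : 0 <= c1) (c20 : 0 <= c2).
Let sq (x : Rn R n) : R := enorm (x : 'rV[R]_n) ^+ 2.
Hypothesis iP : P.-integrable [set: Rn R n] (EFin \o sq).
Hypothesis iQ : Q.-integrable [set: Rn R n] (EFin \o sq).

Lemma measurable_enorm_id : measurable_fun [set: Rn R n] (fun x : Rn R n => enorm (x : 'rV[R]_n)).
Proof. by apply: measurable_enorm => i; exact: measurable_coord. Qed.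

Lemma integrable_of_quadratic_growth (mu : probability (Rn R n) R) (phi : Rn R n -> R) (a b : R) :
  mu.-integrable [set: Rn R n] (EFin \o sq) -> measurable_fun [set: Rn R n] phi ->
  (forall x, `|phi x| <= a + b * sq x) ->
  mu.-integrable [set: Rn R n] (EFin \o phi).
Proof.
move=> isq mphi hphi.
have ib : mu.-integrable [set: Rn R n] (EFin \o (fun x => a + b * sq x)).
  have := integrableD measurableT (finite_measure_integrable_cst mu a measurableT)
    (integrableZl measurableT b isq).
  exact: eq_integrable.
apply: (le_integrable measurableT _ _ ib); first exact/measurable_EFinP.
by move=> x _; rewrite /= !lee_fin (le_trans (hphi x))// ler_norm.
Qed.

Section marginals.
Variable pi : probability (Rn R n * Rn R n)%type R.
Hypothesis cpi : couplings P Q pi.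

Lemma integrable_fst (phi : Rn R n -> R) : P.-integrable [set: Rn R n] (EFin \o phi) ->
  pi.-integrable [set: (Rn R n * Rn R n)%type] (fun z => (phi z.1)%:E).
Proof.
move=> iphi; have mphi := measurable_int _ iphi.
have /integrableP[_ h] := iphi; apply/integrableP; split.
  exact: (measurableT_comp mphi measurable_fst).
rewrite (_ : (\int[pi]_z _ = \int[P]_x `|(EFin \o phi) x|)%E)//.
transitivity (\int[pushforward pi fst]_x `|(EFin \o phi) x|)%E.
  by rewrite ge0_integral_pushforward//; apply: measurableT_comp.
by apply: eq_measure_integral => A mA _; have [] := cpi mA.
Qed.

Lemma integrable_snd (phi : Rn R n -> R) : Q.-integrable [set: Rn R n] (EFin \o phi) ->
  pi.-integrable [set: (Rn R n * Rn R n)%type] (fun z => (phi z.2)%:E).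
Proof.
move=> iphi; have mphi := measurable_int _ iphi.
have /integrableP[_ h] := iphi; apply/integrableP; split.
  exact: (measurableT_comp mphi measurable_snd).
rewrite (_ : (\int[pi]_z _ = \int[Q]_x `|(EFin \o phi) x|)%E)//.
transitivity (\int[pushforward pi snd]_x `|(EFin \o phi) x|)%E.
  by rewrite ge0_integral_pushforward//; apply: measurableT_comp.
by apply: eq_measure_integral => A mA _; have [] := cpi mA.
Qed.

Lemma Rintegral_fst (phi : Rn R n -> R) : P.-integrable [set: Rn R n] (EFin \o phi) ->
  \int[pi]_z (phi z.1) = \int[P]_x phi x.
Proof.
move=> iphi; have mphi := measurable_int _ iphi.
congr fine; transitivity (\int[pushforward pi fst]_x (EFin \o phi) x)%E.
  by rewrite integral_pushforward//; exact: integrable_fst.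
by apply: eq_measure_integral => A mA _; have [] := cpi mA.
Qed.

Lemma Rintegral_snd (phi : Rn R n -> R) : Q.-integrable [set: Rn R n] (EFin \o phi) ->
  \int[pi]_z (phi z.2) = \int[Q]_x phi x.
Proof.
move=> iphi; have mphi := measurable_int _ iphi.
congr fine; transitivity (\int[pushforward pi snd]_x (EFin \o phi) x)%E.
  by rewrite integral_pushforward//; exact: integrable_snd.
by apply: eq_measure_integral => A mA _; have [] := cpi mA.
Qed.

Let dist (z : (Rn R n * Rn R n)%type) : R := enorm ((z.1 : 'rV[R]_n) - z.2).

Let mdist : measurable_fun [set: (Rn R n * Rn R n)%type] dist.
Proof.
apply: measurable_enorm => i.
have -> : (fun t : (Rn R n * Rn R n)%type => ((t.1 : 'rV[R]_n) - t.2) ord0 i) =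
    (fun t => (t.1 : 'rV[R]_n) ord0 i - (t.2 : 'rV[R]_n) ord0 i).
  by apply/funext => t; rewrite !mxE.
by apply: measurable_funB; apply: (measurableT_comp (@measurable_coord R n i)).
Qed.

Lemma integrable_sqr_dist :
  pi.-integrable [set: (Rn R n * Rn R n)%type] (fun z => (dist z ^+ 2)%:E).
Proof.
have i1 := integrableZl measurableT 2 (integrable_fst iP).
have i2 := integrableZl measurableT 2 (integrable_snd iQ).
apply: (le_integrable measurableT _ _ (integrableD measurableT i1 i2)).
  by apply/measurable_EFinP; exact: measurable_funX.
move=> z _; rewrite -!EFinM -EFinD !abse_EFin lee_fin.
rewrite ger0_norm ?sqr_ge0//; apply: le_trans (ler_norm _); exact: sqr_enormB.
Qed.

(** Cauchy-Schwarz is applied separately to the products of [dist] with the norm of each marginal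
    and with the constant 1; the coupling turns the second moments into those of [P] and [Q]. *)
Lemma Rintegral_dist_le :
  pi.-integrable [set: (Rn R n * Rn R n)%type]
    (EFin \o (fun z => (c1 * (enorm (z.1 : 'rV[R]_n) + enorm (z.2 : 'rV[R]_n)) + c2) * dist z)) /\
  \int[pi]_z ((c1 * (enorm (z.1 : 'rV[R]_n) + enorm (z.2 : 'rV[R]_n)) + c2) * dist z) <=
  (c1 * (Num.sqrt (\int[P]_x sq x) + Num.sqrt (\int[Q]_x sq x)) + c2) *
    Num.sqrt (\int[pi]_z (dist z ^+ 2)).
Proof.
set D := Num.sqrt (\int[pi]_z (dist z ^+ 2)).
have m1 : measurable_fun [set: (Rn R n * Rn R n)%type] (fun z => enorm (z.1 : 'rV[R]_n)).
  exact: (measurableT_comp measurable_enorm_id).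
have m2 : measurable_fun [set: (Rn R n * Rn R n)%type] (fun z => enorm (z.2 : 'rV[R]_n)).
  exact: (measurableT_comp measurable_enorm_id).
have i1 := integrable_fst iP.
have i2 := integrable_snd iQ.
have iD := integrable_sqr_dist.
have i1D := integrableM_sqr m1 mdist i1 iD.
have i2D := integrableM_sqr m2 mdist i2 iD.
have icst : pi.-integrable [set: (Rn R n * Rn R n)%type] (fun z => ((cst (1 : R) z) ^+ 2)%:E).
  have := finite_measure_integrable_cst pi ((1 : R) ^+ 2) measurableT; exact: eq_integrable.
have i3D := integrableM_sqr (measurable_cst (1 : R)) mdist icst iD.
have h1 : \int[pi]_z (enorm (z.1 : 'rV[R]_n) * dist z) <= Num.sqrt (\int[P]_x sq x) * D.
  rewrite -(Rintegral_fst iP).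
  by apply: Rintegral_cauchy_schwarz => // z; exact: enorm_ge0.
have h2 : \int[pi]_z (enorm (z.2 : 'rV[R]_n) * dist z) <= Num.sqrt (\int[Q]_x sq x) * D.
  rewrite -(Rintegral_snd iQ).
  by apply: Rintegral_cauchy_schwarz => // z; exact: enorm_ge0.
have h3 : \int[pi]_z (cst (1 : R) z * dist z) <= D.
  apply: (le_trans (Rintegral_cauchy_schwarz _ mdist _ _ icst iD)) => //.
    by move=> z; exact: enorm_ge0.
  rewrite (_ : \int[pi]_x _ = 1) ?sqrtr1 ?mul1r//.
  rewrite (_ : (fun x => _) = cst (1 : R)); last by apply/funext => x; rewrite /= expr1n.
  by rewrite Rintegral_cst//= probability_setT mulr1.
have i12D : pi.-integrable [set: (Rn R n * Rn R n)%type]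
    (EFin \o (fun z => c1 * (enorm (z.1 : 'rV[R]_n) * dist z) + c1 * (enorm (z.2 : 'rV[R]_n) * dist z))).
  have := integrableD measurableT (integrableZl measurableT c1 i1D) (integrableZl measurableT c1 i2D).
  exact: eq_integrable.
have ic1D : pi.-integrable [set: (Rn R n * Rn R n)%type]
    (EFin \o (fun z => c1 * (enorm (z.1 : 'rV[R]_n) * dist z))).
  by have := integrableZl measurableT c1 i1D; exact: eq_integrable.
have ic2D : pi.-integrable [set: (Rn R n * Rn R n)%type]
    (EFin \o (fun z => c1 * (enorm (z.2 : 'rV[R]_n) * dist z))).
  by have := integrableZl measurableT c1 i2D; exact: eq_integrable.
have ic3D : pi.-integrable [set: (Rn R n * Rn R n)%type]
    (EFin \o (fun z => c2 * (cst (1 : R) z * dist z))).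
  by have := integrableZl measurableT c2 i3D; exact: eq_integrable.
split.
  have := integrableD measurableT i12D ic3D; apply: eq_integrable => // z _.
  by rewrite /= -EFinD; congr EFin; ring.
have -> : \int[pi]_z ((c1 * (enorm (z.1 : 'rV[R]_n) + enorm (z.2 : 'rV[R]_n)) + c2) * dist z) =
    c1 * \int[pi]_z (enorm (z.1 : 'rV[R]_n) * dist z) +
    c1 * \int[pi]_z (enorm (z.2 : 'rV[R]_n) * dist z) +
    c2 * \int[pi]_z (cst (1 : R) z * dist z).
  rewrite -(RintegralZl _ measurableT i1D) -(RintegralZl _ measurableT i2D).
  rewrite -(RintegralZl _ measurableT i3D) -(RintegralD measurableT ic1D ic2D).
  rewrite -(RintegralD measurableT i12D ic3D).
  by apply: eq_Rintegral => z _ /=; ring.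
have h1' := ler_wpM2l c10 h1.
have h2' := ler_wpM2l c10 h2.
have h3' := ler_wpM2l c20 h3.
by rewrite !mulrDl mulrDr mulrDl -!mulrA; apply: lerD => //; apply: lerD.
Qed.

End marginals.

Lemma prob_diff_le_coupling (pi : probability (Rn R n * Rn R n)%type R) (B : set (Rn R n)) :
  regular c1 c2 P -> regular c1 c2 Q -> couplings P Q pi -> measurable B ->
  0 <= fine (P B) - fine (Q B) ->
  (fine (P B) - fine (Q B)) ^+ 2 <=
    (c1 * (Num.sqrt (\int[P]_x sq x) + Num.sqrt (\int[Q]_x sq x)) + c2) *
    Num.sqrt (\int[pi]_z (enorm ((z.1 : 'rV[R]_n) - z.2) ^+ 2)).
Proof.
move=> [lam [p [hlam p0 dp Pp gp]]] [lam' [q [hlam' q0 dq Qq gq]]] cpi mB PQB.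
have sflam := is_lebesgue_sigma_finite hlam.
pose slam : {sigma_finite_measure set (Rn R n) -> \bar R} :=
  HB.pack (Measure.sort lam)
    (isSFinite.Build _ _ _ (Measure.sort lam) (sfinite_measure_sigma_finite sflam))
    (isSigmaFinite.Build _ _ _ (Measure.sort lam) sflam).
have {}Pp A : measurable A -> P A = (\int[slam]_(x in A) (p x)%:E)%E by exact: Pp.
(* Both densities are now taken with respect to the same Lebesgue measure. *)
have {}Qq A : measurable A -> Q A = (\int[slam]_(x in A) (q x)%:E)%E.
  move=> mA; rewrite Qq//; apply: eq_measure_integral => C mC _.
  exact: is_lebesgue_unique.
have mp : measurable_fun [set: Rn R n] (p : Rn R n -> R).
  by apply: continuous_measurable => x; exact: differentiable_continuous.
have mq : measurable_fun [set: Rn R n] (q : Rn R n -> R).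
  by apply: continuous_measurable => x; exact: differentiable_continuous.
pose phi (x : Rn R n) : R := ln (p x) - ln (q x).
have mphi : measurable_fun [set: Rn R n] phi.
  by apply: measurable_funB; apply: (measurableT_comp (@measurable_ln R)).
have lipphi (x y : Rn R n) : `|phi x - phi y| <=
    2 * ((c1 * (enorm (x : 'rV[R]_n) + enorm (y : 'rV[R]_n)) + c2) *
         enorm ((x : 'rV[R]_n) - y)).
  have -> : phi x - phi y = (ln (p x) - ln (p y)) - (ln (q x) - ln (q y)).
    by rewrite /phi; ring.
  have := ln_diff_le_of_grad_log2 x y c10 c20 p0 dp gp.
  have := ln_diff_le_of_grad_log2 x y c10 c20 q0 dq gq.
  have := ler_normB (ln (p x) - ln (p y)) (ln (q x) - ln (q y)).
  lra.
(* Comparison with the origin, using [e <= 1 + e^2] for the linear term: finite second moments then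
   make [phi] integrable under both laws. *)
have growth (x : Rn R n) : `|phi x| <= (`|phi 0| + 2 * c2) + (2 * c1 + 2 * c2) * sq x.
  have h1 := lipphi x 0.
  have h2 : `|phi x| <= `|phi x - phi 0| + `|phi 0|.
    by rewrite -[X in `|X| <= _](subrK (phi 0)) ler_normD.
  have h0 : enorm (0 : 'rV[R]_n) = 0.
    by rewrite -(scale0r 0) enormZ normr0 mul0r.
  move: h1; rewrite subr0 h0 addr0 /sq; set e := enorm _ => h1.
  have h3 : e <= 1 + e ^+ 2 by have := sqr_ge0 (e - 1); have := sqr_ge0 e; lra.
  have := ler_wpM2l c20 h3; lra.
have iphiP := integrable_of_quadratic_growth iP mphi growth.
have iphiQ := integrable_of_quadratic_growth iQ mphi growth.
set K := (X in X * _); set w := Num.sqrt _.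
have K0 : 0 <= K by rewrite /K addr_ge0// mulr_ge0// addr_ge0// sqrtr_ge0.
have J : \int[P]_x phi x - \int[Q]_x phi x <= 2 * (K * w).
  rewrite -(Rintegral_fst cpi iphiP) -(Rintegral_snd cpi iphiQ).
  have i1 := integrable_fst cpi iphiP.
  have i2 := integrable_snd cpi iphiQ.
  rewrite -(RintegralB measurableT i1 i2).
  have [idist hdist] := Rintegral_dist_le cpi.
  apply: (le_trans _ (ler_wpM2l (ler0n R 2) hdist)).
  rewrite -(RintegralZl _ measurableT idist).
  apply: le_Rintegral => //.
  - by have := integrableB measurableT i1 i2; exact: eq_integrable.
  - by have := integrableZl measurableT 2 idist; exact: eq_integrable.
  - by move=> z _; apply: (le_trans (ler_norm _)); exact: lipphi.
(* With [J <= 2 K w] the divergence bound reads [t / 2 + (K w / 2) / t], which has the form required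
   by [sqr_le_of_amgm]. *)
have -> : K * w = 4 * 2^-1 * (K * w / 2) by field.
apply: sqr_le_of_amgm => //; first by rewrite divr_ge0// mulr_ge0// sqrtr_ge0.
move=> t t0.
have := @prob_diff_le_jeffreys _ _ _ slam P Q p q B t mp mq p0 q0 Pp Qq iphiP iphiQ mB t0.
move=> /le_trans; apply; rewrite mulrC -mulrA lerD2l ler_wpM2l ?invr_ge0 ?(ltW t0)//.
by move: J; set j := _ - _ => J; lra.
Qed.

End coupling.

(* Layer cake: [delta] bounds the difference of the tail functions, which both
   vanish beyond [L]. *)
Lemma Rintegral_le_of_prob_le d (T : measurableType d) (R : realType)
    (mu nu : probability T R) (F : T -> R) (L delta : R) :
  measurable_fun [set: T] F -> (forall x, 0 <= F x) -> (forall x, F x <= L) -> 0 <= L ->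
  0 <= delta -> (forall A, measurable A -> (mu A <= nu A + delta%:E)%E) ->
  \int[mu]_x F x <= \int[nu]_x F x + L * delta.
Proof.
move=> mF F0 FL L0 delta0 hA.
have iF (m : probability T R) : m.-integrable [set: T] (EFin \o F).
  apply: measurable_bounded_integrable => //.
    by rewrite ltey_eq fin_num_measure.
  exists L; split; [exact: num_real|move=> x Lx y _]; rewrite /= ger0_norm//.
  exact: le_trans (FL y) (ltW Lx).
pose X (m : probability T R) : {RV m >-> R} :=
  HB.pack F (isMeasurableFun.Build _ _ _ _ F mF).
pose leb : {measure set (measurableTypeR R) -> \bar R} := @lebesgue_measure R.
have layer (m : probability T R) :
    (\int[m]_x (F x)%:E = \int[leb]_(r in `[0%R, +oo[) ccdf (X m) r)%E.
  by rewrite -ge0_expectation_ccdf// expectation_def.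
(* The error [delta] on the tails, accumulated over levels in [[0, L]], has area [L * delta]. *)
have mL : (\int[leb]_(r in `[0%R, +oo[) (delta * \1_`[0%R, L]%classic r)%:E = (L * delta)%:E)%E.
  under eq_integral do rewrite EFinM.
  rewrite ge0_integralZl_EFin//; last by apply/measurable_EFinP; exact: measurable_indic.
  rewrite integral_indic//= setIidl; last first.
    by move=> r /=; rewrite !in_itv/= andbT => /andP[].
  rewrite [X in (_ * X)%E]lebesgue_measure_itv/= lte_fin.
  have [L_gt0|L_le0] := ltP 0 L; first by rewrite oppr0 adde0 -EFinM mulrC.
  by rewrite mule0 (@le_anti _ _ L 0) ?L_le0 ?L0// mul0r.
have key : (\int[mu]_x (F x)%:E <= \int[nu]_x (F x)%:E + (L * delta)%:E)%E.
  rewrite !layer -mL -ge0_integralD//=.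
  - apply: ge0_le_integral => //=.
    + by apply: measurable_funTS; exact: ccdf_measurable.
    + apply: emeasurable_funD; first by apply: measurable_funTS; exact: ccdf_measurable.
      by apply/measurable_EFinP; exact: measurable_funM.
    + move=> r; rewrite in_itv/= andbT => r0.
      rewrite indicE; have [rL|Lr] := leP r L.
        rewrite mem_set/= ?in_itv/= ?r0// mulr1; apply: hA.
        by rewrite -[X in measurable X]setTI; exact: (mF measurableT _ (measurable_itv _)).
      rewrite /ccdf/= /distribution /pushforward/=.
      rewrite (_ : F @^-1` _ = set0).
        by rewrite measure0 adde_ge0// lee_fin mulr_ge0.
      apply/seteqP; split => // x /=; rewrite in_itv/= andbT => rFx.
      by have := lt_trans (lt_le_trans rFx (FL x)) Lr; rewrite ltxx.
  - by apply: measurable_funTS; exact: ccdf_measurable.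
  - by move=> r _; rewrite lee_fin mulr_ge0.
  - by apply/measurable_EFinP; exact: measurable_funM.
have fin (m : probability T R) : (\int[m]_x (F x)%:E)%E \is a fin_num.
  exact: (integrable_fin_num measurableT (iF m)).
rewrite /Rintegral -[X in _ <= _ + X]/(fine (L * delta)%:E) -fineD//.
apply: fine_le => //; first exact: fin.
  by rewrite (@fin_numD _ _ (L * delta)%:E) fin.
exact: fin.
Qed.

(** It keeps the infimum in [W2sq] from being taken over the empty set, where [fine] would turn
    [+oo] into 0. *)
Lemma product_coupling (R : realType) (n : nat) (P Q : probability (Rn R n) R) :
  couplings P Q (P \x Q)%E.
Proof.
move=> A mA; split; rewrite /pushforward.
- rewrite (_ : fst @^-1` A = A `*` setT); last by apply/seteqP; split => z //= [].
  transitivity (P A * Q setT)%E; first exact: product_measure1E.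
  by rewrite probability_setT mule1.
- rewrite (_ : snd @^-1` A = setT `*` A); last by apply/seteqP; split => z //= [].
  transitivity (P setT * Q A)%E; first exact: product_measure1E.
  by rewrite probability_setT mul1e.
Qed.

Section wasserstein.
Context (R : realType) (n : nat) (c1 c2 : R) (P Q : probability (Rn R n) R).
Hypotheses (c10 : 0 <= c1) (c20 : 0 <= c2).
Let sq (x : Rn R n) : R := enorm (x : 'rV[R]_n) ^+ 2.
Hypothesis iP : P.-integrable [set: Rn R n] (EFin \o sq).
Hypothesis iQ : Q.-integrable [set: Rn R n] (EFin \o sq).

Let cost (pi : probability (Rn R n * Rn R n)%type R) : R :=
  \int[pi]_z (enorm ((z.1 : 'rV[R]_n) - z.2) ^+ 2).

Let costE pi : couplings P Q pi ->
  (\int[pi]_z (enorm ((z.1 : 'rV[R]_n) - z.2) ^+ 2)%:E)%E = (cost pi)%:E.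
Proof.
move=> cpi; rewrite /cost /Rintegral fineK//.
by apply: integrable_fin_num => //; exact: (integrable_sqr_dist iP iQ cpi).
Qed.

Let cost_ge0 pi : 0 <= cost pi.
Proof. by apply: Rintegral_ge0 => z _; exact: sqr_ge0. Qed.

Lemma W2sq_ge0 : 0 <= W2sq P Q.
Proof.
apply: fine_ge0; apply: le_ereal_inf_tmp => _ [pi cpi <-].
by rewrite costE// lee_fin cost_ge0.
Qed.

(** The lower bound passes through [fine] because the infimum is finite: it lies between 0 and the
    cost of the product coupling. *)
Lemma le_W2sq (a : R) : (forall pi, couplings P Q pi -> a <= cost pi) -> a <= W2sq P Q.
Proof.
move=> h; pose S := [set (\int[pi]_z ((enorm ((z.1 : 'rV[R]_n) - z.2)) ^+ 2)%:E)%E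
  | pi in couplings P Q].
have lb : (a%:E <= ereal_inf S)%E.
  by apply: le_ereal_inf_tmp => _ [pi cpi <-]; rewrite costE// lee_fin; exact: h.
have inf0 : (0 <= ereal_inf S)%E.
  by apply: le_ereal_inf_tmp => _ [pi cpi <-]; rewrite costE// lee_fin cost_ge0.
have ub : (ereal_inf S <= (cost (P \x Q)%E)%:E)%E.
  apply: ereal_inf_lbound; exists (P \x Q)%E; first exact: product_coupling.
  by rewrite costE//; exact: product_coupling.
have fin : ereal_inf S \is a fin_num.
  by rewrite ge0_fin_numE//; apply: le_lt_trans ub _; rewrite ltry.
by rewrite -lee_fin /W2sq -/S fineK.
Qed.

(** Raised to the fourth power, the estimate is linear in the cost of each coupling, so it passes to
    the infimum without an optimal coupling. *)
Lemma prob_diff_le_W2 (B : set (Rn R n)) :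
  regular c1 c2 P -> regular c1 c2 Q -> measurable B ->
  (P B <= Q B + (Num.sqrt (c1 * (Num.sqrt (\int[P]_x sq x) + Num.sqrt (\int[Q]_x sq x)) + 2 * c2)
                 * powR (W2sq P Q) (4^-1))%:E)%E.
Proof.
move=> rP rQ mB.
set a := Num.sqrt (\int[P]_x sq x); set b := Num.sqrt (\int[Q]_x sq x).
set K := _ + 2 * c2; set W := W2sq P Q.
have W0 : 0 <= W by exact: W2sq_ge0.
have ab0 : 0 <= c1 * (a + b) by rewrite mulr_ge0// addr_ge0// sqrtr_ge0.
have K0 : 0 <= K by rewrite /K addr_ge0// mulr_ge0.
set r := powR W _.
have r0 : 0 <= r by exact: powR_ge0.
have r4 : r ^+ 4 = W.
  by rewrite /r -powR_mulrn ?powR_ge0// -powRrM mulVf ?powRr1// pnatr_eq0.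
set D := fine (P B) - fine (Q B).
suff DKr : D <= Num.sqrt K * r.
  rewrite -(fineK (fin_num_measure P _ mB)) -(fineK (fin_num_measure Q _ mB)).
  by rewrite -EFinD lee_fin -lerBlDl.
have [D0|/ltW D0] := leP D 0; first by rewrite (le_trans D0)// mulr_ge0// sqrtr_ge0.
have hpi pi : couplings P Q pi -> D ^+ 4 <= K ^+ 2 * cost pi.
  move=> cpi; have := prob_diff_le_coupling c10 c20 iP iQ rP rQ cpi mB D0.
  rewrite -/a -/b -/(cost pi) => h.
  have h2 : D ^+ 2 <= K * Num.sqrt (cost pi).
    (* The constant [c2] of the coupling estimate is relaxed to [2 * c2]. *)
    by apply: (le_trans h); rewrite ler_wpM2r ?sqrtr_ge0// /K lerD2l ler_peMl// ler1n.
  have -> : D ^+ 4 = (D ^+ 2) ^+ 2 by rewrite -exprM.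
  rewrite -(sqr_sqrtr (cost_ge0 pi)) -exprMn.
  by rewrite ler_pXn2r// ?nnegrE ?sqr_ge0// mulr_ge0// sqrtr_ge0.
have D4 : D ^+ 4 <= K ^+ 2 * W.
  (* The infimum is reached after division by [K^2]; for [K = 0] a single coupling already gives the
     claim. *)
  have [K_eq0|Kn0] := eqVneq K 0.
    by have := hpi _ (product_coupling P Q); rewrite K_eq0 expr0n/= !mul0r.
  have K2 : 0 < K ^+ 2 by rewrite exprn_gt0// lt_neqAle eq_sym Kn0.
  rewrite mulrC -ler_pdivrMr//; apply: le_W2sq => pi cpi.
  by rewrite ler_pdivrMr// mulrC; exact: hpi.
rewrite -(@ler_pXn2r _ 4)// ?nnegrE ?mulr_ge0 ?sqrtr_ge0//.
have -> : (Num.sqrt K * r) ^+ 4 = (Num.sqrt K ^+ 2) ^+ 2 * r ^+ 4.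
  by rewrite -exprM exprMn.
by rewrite r4 sqr_sqrtr.
Qed.

End wasserstein.

(** * The generalization bound *)

(** The right side minus the left is the variance of [x] under the weights [lambda]. *)
Lemma sqr_convex_sum_le (R : realFieldType) (S : nat) (lambda x : 'I_S -> R) :
  (forall s, 0 <= lambda s) -> \sum_(s < S) lambda s = 1 ->
  (\sum_(s < S) lambda s * x s) ^+ 2 <= \sum_(s < S) lambda s * x s ^+ 2.
Proof.
move=> l0 l1; set m := \sum_(s < S) lambda s * x s.
have : 0 <= \sum_(s < S) lambda s * (x s - m) ^+ 2.
  by apply: sumr_ge0 => s _; rewrite mulr_ge0// sqr_ge0.
have -> : \sum_(s < S) lambda s * (x s - m) ^+ 2 =
    \sum_(s < S) lambda s * x s ^+ 2 - 2 * m * m + m ^+ 2 * \sum_(s < S) lambda s.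
  have -> : 2 * m * m = \sum_(s < S) 2 * m * (lambda s * x s) by rewrite -mulr_sumr.
  by rewrite [m ^+ 2 * _]mulr_sumr -sumrB -big_split/=; apply: eq_bigr => s _; ring.
rewrite l1; lra.
Qed.

(** Jensen's inequality for the fourth root: [sqr_convex_sum_le] is applied to the fourth roots and
    then to their squares. *)
Lemma powR_fourth_convex_sum_le (R : realType) (S : nat) (lambda w : 'I_S -> R) :
  (forall s, 0 <= lambda s) -> \sum_(s < S) lambda s = 1 -> (forall s, 0 <= w s) ->
  \sum_(s < S) lambda s * powR (w s) (4^-1) <= powR (\sum_(s < S) lambda s * w s) (4^-1).
Proof.
move=> l0 l1 w0.
have pow4 (a : R) : 0 <= a -> (powR a (4^-1)) ^+ 4 = a.
  by move=> a0; rewrite -powR_mulrn ?powR_ge0// -powRrM mulVf ?powRr1// pnatr_eq0.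
have lw0 : 0 <= \sum_(s < S) lambda s * w s.
  by apply: sumr_ge0 => s _; rewrite mulr_ge0.
set t := \sum_(s < S) _.
have t0 : 0 <= t by apply: sumr_ge0 => s _; rewrite mulr_ge0// powR_ge0.
rewrite -(@ler_pXn2r _ 4)// ?nnegrE ?powR_ge0// pow4//.
have -> : t ^+ 4 = (t ^+ 2) ^+ 2 by rewrite -exprM.
have h1 := sqr_convex_sum_le (fun s => powR (w s) (4^-1)) l0 l1.
have h2 := sqr_convex_sum_le (fun s => powR (w s) (4^-1) ^+ 2) l0 l1.
apply: (@le_trans _ _ ((\sum_(s < S) lambda s * powR (w s) (4^-1) ^+ 2) ^+ 2)).
  rewrite ler_pXn2r// ?nnegrE ?sqr_ge0//.
  by apply: sumr_ge0 => s _; rewrite mulr_ge0// sqr_ge0.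
apply: (le_trans h2); apply: ler_sum => s _.
by rewrite -exprM pow4.
Qed.

Lemma Rintegral_le_W2 (R : realType) (m n : nat) (mu nu : probability (Rn R m) R)
    (f : Rn R m -> Rn R n) (c1 c2 L : R) (F : Rn R m -> R) :
  measurable_fun [set: Rn R m] f ->
  {in msupport mu `|` msupport nu &, injective f} ->
  mu.-integrable [set: Rn R m] (fun x => (enorm (f x : 'rV[R]_n) ^+ 2)%:E) ->
  nu.-integrable [set: Rn R m] (fun x => (enorm (f x : 'rV[R]_n) ^+ 2)%:E) ->
  0 <= c1 -> 0 <= c2 ->
  regular c1 c2 (pushforward mu f) -> regular c1 c2 (pushforward nu f) ->
  measurable_fun [set: Rn R m] F -> (forall x, 0 <= F x) -> (forall x, F x <= L) -> 0 <= L ->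
  \int[mu]_x F x <= \int[nu]_x F x +
    L * (Num.sqrt (c1 * (Num.sqrt (\int[mu]_x (enorm (f x : 'rV[R]_n) ^+ 2)) +
                         Num.sqrt (\int[nu]_x (enorm (f x : 'rV[R]_n) ^+ 2))) + 2 * c2) *
         powR (W2sq (pushforward mu f) (pushforward nu f)) (4^-1)).
Proof.
move=> mf injf imu inu c10 c20 rmu rnu mF F0 FL L0.
pose fm : {mfun Rn R m >-> Rn R n} := HB.pack f (isMeasurableFun.Build _ _ _ _ f mf).
pose sq (x : Rn R n) : R := enorm (x : 'rV[R]_n) ^+ 2.
have msq : measurable_fun [set: Rn R n] (EFin \o sq).
  by apply/measurable_EFinP; apply: measurable_funX; exact: measurable_enorm_id.
have isq (r : probability (Rn R m) R) :
    r.-integrable [set: Rn R m] (fun x => (enorm (f x : 'rV[R]_n) ^+ 2)%:E) ->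
    (distribution r fm).-integrable [set: Rn R n] (EFin \o sq).
  by move=> ir; apply: integrable_pushforward.
have m2E (r : probability (Rn R m) R) :
    r.-integrable [set: Rn R m] (fun x => (enorm (f x : 'rV[R]_n) ^+ 2)%:E) ->
    \int[distribution r fm]_x sq x = \int[r]_x (enorm (f x : 'rV[R]_n) ^+ 2).
  by move=> ir; congr fine; rewrite integral_pushforward.
apply: Rintegral_le_of_prob_le => //; first by rewrite mulr_ge0 ?sqrtr_ge0 ?powR_ge0.
(* The arbitrary slack [e] absorbs the loss in replacing [A] by the preimage of a Borel set [B], on
   which the pushforwards are compared. *)
move=> A mA; apply/lee_addgt0Pr => e e0.
have [B [mB muB nuB]] := approx_by_preimage mf injf mA e0.
apply: (le_trans muB); apply: leeD => //.
have := @prob_diff_le_W2 R n c1 c2 (distribution mu fm) (distribution nu fm)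
  c10 c20 (isq _ imu) (isq _ inu) B rmu rnu mB.
rewrite !m2E// => /le_trans; apply; exact: leeD.
Qed.

Unset Implicit Arguments.
Set Strict Implicit.

Theorem theorem1 (R : realType) (d d' : nat) (dY : measure_display)
  (Y : measurableType dY) (ell : Y -> Y -> R) (L : R) (S : nat)
  (* unseen domain u = (mu_u, f_u, g_u) *)
  (mu_u : probability (Rn R d) R) (f_u : Rn R d -> Rn R d') (g_u : Rn R d' -> Y)
  (* seen domains s = (mu_s s, f_s s, g_s s), s < S *)
  (mu_s : 'I_S -> probability (Rn R d) R) (f_s : 'I_S -> Rn R d -> Rn R d')
  (g_s : 'I_S -> Rn R d' -> Y)
  (* hypothesis h = g \o f *)
  (f : Rn R d -> Rn R d') (g : Rn R d' -> Y)
  (c1 c2 : R) (lambda : 'I_S -> R) :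
  (* (i) assumptions on the loss *)
  (forall y1 y2, 0 <= ell y1 y2) ->
  (forall y1 y2, ell y1 y2 = ell y2 y1) ->
  0 < L -> (forall y1 y2, ell y1 y2 <= L) ->
  (forall y1 y2 y3, ell y1 y3 <= ell y1 y2 + ell y2 y3) ->
  (* measurability (implicit standing assumption) *)
  measurable_fun [set: (Y * Y)%type] (fun z => ell z.1 z.2) ->
  measurable_fun [set: Rn R d] f -> measurable_fun [set: Rn R d'] g ->
  measurable_fun [set: Rn R d] f_u -> measurable_fun [set: Rn R d'] g_u ->
  (forall s, measurable_fun [set: Rn R d] (f_s s)) ->
  (forall s, measurable_fun [set: Rn R d'] (g_s s)) ->
  (* (ii) f is invertible on the data manifold (union of the supports) *)
  {in msupport mu_u `|` \bigcup_s msupport (mu_s s) &, injective f} ->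
  (* finite second moments of the representations (so that C and W_2 are finite) *)
  mu_u.-integrable [set: Rn R d] (fun x => ((enorm (f x : 'rV[R]_d')) ^+ 2)%:E) ->
  (forall s, (mu_s s).-integrable [set: Rn R d]
                (fun x => ((enorm (f x : 'rV[R]_d')) ^+ 2)%:E)) ->
  (* regularity of the pushforwards *)
  0 <= c1 -> 0 <= c2 ->
  regular c1 c2 (pushforward mu_u f) ->
  (forall s, regular c1 c2 (pushforward (mu_s s) f)) ->
  (* convex weights *)
  (forall s, 0 <= lambda s) -> \sum_(s < S) lambda s = 1 ->
  let h := fun x => g (f x) in
  let h_u := fun x => g_u (f_u x) in
  let h_s := fun s x => g_s s (f_s s x) in
  let R_u := expect mu_u (fun x => ell (h x) (h_u x)) in
  let R_s := fun s => expect (mu_s s) (fun x => ell (h x) (h_s s x)) in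
  let sigma := fun s => Num.min (expect mu_u (fun x => ell (h_u x) (h_s s x)))
                                (expect (mu_s s) (fun x => ell (h_u x) (h_s s x))) in
  let m2 := fun (mu : probability (Rn R d) R) =>
              expect mu (fun x => (enorm (f x : 'rV[R]_d')) ^+ 2) in
  let C := \big[Num.max/0]_(s < S)
             Num.sqrt (c1 * (Num.sqrt (m2 mu_u) + Num.sqrt (m2 (mu_s s))) + 2 * c2) in
  R_u <= \sum_(s < S) lambda s * R_s s
         + L * C * powR (\sum_(s < S) lambda s *
                          W2sq (pushforward mu_u f) (pushforward (mu_s s) f)) (4^-1)
         + \sum_(s < S) lambda s * sigma s.
Proof.
move=> ell0 ellC L0 ellL ellT mell mf mg mf_u mg_u mf_s mg_s injf imu ims c10 c20 ru rs l0 l1.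
pose h := fun x => g (f x).
pose h_u := fun x => g_u (f_u x).
pose h_s := fun s x => g_s s (f_s s x).
pose R_u := expect mu_u (fun x => ell (h x) (h_u x)).
pose R_s := fun s => expect (mu_s s) (fun x => ell (h x) (h_s s x)).
pose sigma := fun s => Num.min (expect mu_u (fun x => ell (h_u x) (h_s s x)))
                               (expect (mu_s s) (fun x => ell (h_u x) (h_s s x))).
pose m2 := fun mu : probability (Rn R d) R =>
             expect mu (fun x => (enorm (f x : 'rV[R]_d')) ^+ 2).
pose r s := powR (W2sq (pushforward mu_u f) (pushforward (mu_s s) f)) (4^-1).
pose Cs s := Num.sqrt (c1 * (Num.sqrt (m2 mu_u) + Num.sqrt (m2 (mu_s s))) + 2 * c2).
pose C := \big[Num.max/0]_(s < S) Cs s.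
change (R_u <= \sum_(s < S) lambda s * R_s s
  + L * C * powR (\sum_(s < S) lambda s *
                   W2sq (pushforward mu_u f) (pushforward (mu_s s) f)) (4^-1)
  + \sum_(s < S) lambda s * sigma s).
have mh : measurable_fun [set: Rn R d] h by exact: (measurableT_comp mg mf).
have mh_u : measurable_fun [set: Rn R d] h_u by exact: (measurableT_comp mg_u mf_u).
have mh_s s : measurable_fun [set: Rn R d] (h_s s).
  exact: (measurableT_comp (mg_s s) (mf_s s)).
have mloss (k k' : Rn R d -> Y) : measurable_fun [set: Rn R d] k ->
    measurable_fun [set: Rn R d] k' -> measurable_fun [set: Rn R d] (fun x => ell (k x) (k' x)).
  by move=> mk mk'; exact: (measurableT_comp mell (measurable_fun_pair mk mk')).
have iloss (mu : probability (Rn R d) R) (k k' : Rn R d -> Y) :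
    measurable_fun [set: Rn R d] k -> measurable_fun [set: Rn R d] k' ->
    mu.-integrable [set: Rn R d] (EFin \o (fun x => ell (k x) (k' x))).
  move=> mk mk'; apply: measurable_bounded_integrable => //.
  - by rewrite ltey_eq fin_num_measure.
  - exact: mloss.
  - exists L; split; [exact: num_real|move=> x Lx y _]; rewrite /= ger0_norm//.
    exact: le_trans (ellL _ _) (ltW Lx).
have tri (mu : probability (Rn R d) R) (k k' k'' : Rn R d -> Y) :
    measurable_fun [set: Rn R d] k -> measurable_fun [set: Rn R d] k' ->
    measurable_fun [set: Rn R d] k'' ->
    \int[mu]_x ell (k x) (k'' x) <=
      \int[mu]_x ell (k x) (k' x) + \int[mu]_x ell (k' x) (k'' x).
  move=> mk mk' mk''.
  rewrite -(RintegralD measurableT (iloss mu k k' mk mk') (iloss mu k' k'' mk' mk'')).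
  apply: le_Rintegral => //; first exact: iloss.
  have := integrableD measurableT (iloss mu k k' mk mk') (iloss mu k' k'' mk' mk'').
  exact: eq_integrable.
have shift s (k k' : Rn R d -> Y) :
    measurable_fun [set: Rn R d] k -> measurable_fun [set: Rn R d] k' ->
    \int[mu_u]_x ell (k x) (k' x) <= \int[mu_s s]_x ell (k x) (k' x) + L * (Cs s * r s).
  move=> mk mk'.
  apply: (Rintegral_le_W2 (c1 := c1) (c2 := c2)) => //; [|exact: mloss|exact: ltW].
  move=> x y; rewrite !inE => hx hy; apply: injf; rewrite inE.
  - by case: hx => hx; [left|right; exists s].
  - by case: hy => hy; [left|right; exists s].
have C_ge s : Cs s <= C by exact: (le_bigmax 0 Cs s).
have bound s : R_u <= R_s s + L * (C * r s) + sigma s.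
  have r0 : 0 <= r s by exact: powR_ge0.
  have LC : L * (Cs s * r s) <= L * (C * r s) by rewrite ler_wpM2l ?(ltW L0)// ler_wpM2r.
  apply: (@le_trans _ _ (R_s s + L * (Cs s * r s) + sigma s)); last by rewrite lerD2r lerD2l.
  have symm (mu : probability (Rn R d) R) :
      \int[mu]_x ell (h_s s x) (h_u x) = \int[mu]_x ell (h_u x) (h_s s x).
    by apply: eq_Rintegral => x _; exact: ellC.
  rewrite /sigma.
  (* Each value of the minimum has its own order of steps: triangle inequality under [mu_u] and then
     change of measure, or change of measure and then triangle inequality under [mu_s s]. *)
  have [_|_] := leP (expect mu_u (fun x => ell (h_u x) (h_s s x)))
                    (expect (mu_s s) (fun x => ell (h_u x) (h_s s x))).
  - apply: (le_trans (tri mu_u h (h_s s) h_u mh (mh_s s) mh_u)).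
    by apply: lerD; [exact: shift|rewrite symm].
  - apply: (le_trans (shift s h h_u mh mh_u)).
    rewrite [leRHS]addrAC; apply: lerD => //.
    by apply: (le_trans (tri (mu_s s) h (h_s s) h_u mh (mh_s s) mh_u)); rewrite symm.
have -> : R_u = \sum_(s < S) lambda s * R_u by rewrite -mulr_suml l1 mul1r.
apply: (@le_trans _ _ (\sum_(s < S) lambda s * (R_s s + L * (C * r s) + sigma s))).
  by apply: ler_sum => s _; rewrite ler_wpM2l.
have -> : \sum_(s < S) lambda s * (R_s s + L * (C * r s) + sigma s) =
    \sum_(s < S) lambda s * R_s s + L * C * (\sum_(s < S) lambda s * r s) +
    \sum_(s < S) lambda s * sigma s.
  by rewrite mulr_sumr -!big_split/=; apply: eq_bigr => s _; ring.
rewrite lerD2r lerD2l; apply: ler_wpM2l.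
  (* [C] is nonnegative because its maximum starts from 0. *)
  by rewrite mulr_ge0 ?(ltW L0)//; exact: bigmax_ge_id.
apply: powR_fourth_convex_sum_le => // s.
pose fm : {mfun Rn R d >-> Rn R d'} := HB.pack f (isMeasurableFun.Build _ _ _ _ f mf).
have msq : measurable_fun [set: Rn R d'] (fun x : Rn R d' => (enorm (x : 'rV[R]_d') ^+ 2)%:E).
  by apply/measurable_EFinP; apply: measurable_funX; exact: measurable_enorm_id.
apply: (@W2sq_ge0 R d' (distribution mu_u fm) (distribution (mu_s s) fm)).
- by apply: integrable_pushforward.
- by have imss := ims s; apply: integrable_pushforward.
Qed.
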